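(* Let $\bar s_1<\bar s_2<\dots<\bar s_{\mathcal L}$ be positive half-integers, with conventions $\bar s_0=0$, $\bar s_{\mathcal L+1}=\infty$, and put $\hbar_j=\frac{\pi}{2(\bar s_{j+1}-\bar s_j)}$ for $0\le j\le \mathcal L$ (so $\hbar_{\mathcal L}=0$), and $\mathcal R_j=\,]\bar s_j,\bar s_{j+1}[\,\cap\tfrac12\mathbb Z$. Let $\mathcal D_1,\dots,\mathcal D_{\mathcal L}$ be nonnegative integers, with $\mathcal D_0=\mathcal D_{\mathcal L+1}=0$, and let $\tilde\lambda_{j,d}\in\mathbb R$ ($1\le j\le\mathcal L$, $1\le d\le \mathcal D_j$) be hole rapidities. For each $m\in\mathcal R=\bigcup_{j=0}^{\mathcal L}\mathcal R_j$ let $\tilde\nu_m\ge0$ be an integer, only finitely many nonzero, and let $\lambda_{m,\ell}\in\mathbb R$ ($1\le\ell\le\tilde\nu_m$). For $1\le j\le \mathcal L$ define the (generalized) functions $$\mathfrak r_{\bar s_j}(\lambda)=\frac1{2\pi}\Big(\sum_{d=1}^{\mathcal D_{j-1}}\kappa^{(\hbar_{j-1})}_{2(\bar s_j-\bar s_{j-1})-1}(\lambda-\tilde\lambda_{j-1,d})+\sum_{d=1}^{\mathcal D_{j+1}}\kappa^{(\hbar_j)}_{2(\bar s_{j+1}-\bar s_j)-1}(\lambda-\tilde\lambda_{j+1,d})$$ $$\qquad+\sum_{d=1}^{\mathcal D_j}\big(\kappa^{(\hbar_j)}_1(\lambda-\tilde\lambda_{j,d})+\kappa^{(\hbar_{j-1})}_1(\lambda-\tilde\lambda_{j,d})-2\pi\delta(\lambda-\tilde\lambda_{j,d})\big)\Big),$$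 $$\mathfrak c_{\bar s_j}(\lambda)=-\frac1{2\pi}\sum_{m\in\mathcal R_{j-1}}\sum_{\ell=1}^{\tilde\nu_m}\gamma^{(\hbar_{j-1})}_{2(\bar s_j-m)}(\lambda-\lambda_{m,\ell})-\frac1{2\pi}\sum_{m\in\mathcal R_j}\sum_{\ell=1}^{\tilde\nu_m}\gamma^{(\hbar_j)}_{2(m-\bar s_j)}(\lambda-\lambda_{m,\ell}),$$ and for $s\in\{\bar s_1,\dots,\bar s_{\mathcal L}\}$ set $$\Delta E^{(s)}=-\sum_{j=1}^{\mathcal L}\int_{-\infty}^{\infty}\big(\mathfrak r_{\bar s_j}(\lambda)+\mathfrak c_{\bar s_j}(\lambda)\big)\Psi^{(\bar s_j)}_{2s}(\lambda)\,d\lambda-\sum_{m\in\mathcal R}\sum_{\ell=1}^{\tilde\nu_m}\Psi^{(m)}_{2s}(\lambda_{m,\ell}).$$ Then for every $1\le j\le\mathcal L$, $$\Delta E^{(\bar s_j)}=\sum_{d=1}^{\mathcal D_j}\frac{\pi}{\cosh(\pi\tilde\lambda_{j,d})}.$$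
   Context: Physical meaning: for an $L_0$-regular $gl(2)$ spin chain containing the spins $\bar s_1,\dots,\bar s_{\mathcal L}$ (densities $\rho_{\bar s_j}$), an excited state consists of $\mathcal D_j$ holes (rapidities $\tilde\lambda_{j,d}$) in the filled sea of $2\bar s_j$-strings and $\tilde\nu_m$ new $2m$-strings (centers $\lambda_{m,\ell}$) for spins $m\notin\{\bar s_j\}$; in the thermodynamic limit with string hypothesis the sea densities are $\rho_{\bar s_j}/(2\cosh\pi\lambda)+\frac1L(\mathfrak r_{\bar s_j}+\mathfrak c_{\bar s_j})$, and the energy density of $H^{(s)}$ is $\mathcal E_0^{(s)}+\frac1L\Delta E^{(s)}$ with $\Delta E^{(s)}$ as defined in the claim. Notation: the Fourier transform is $\hat f(p)=\frac1{2\pi}\int e^{ip\lambda}f(\lambda)d\lambda$. For $\hbar>0$ and $0<r<\pi/\hbar$, $\gamma^{(\hbar)}_r(\lambda)=\frac{2\hbar\sin(\hbar r)}{\cosh(2\hbar\lambda)-\cos(\hbar r)}$, with $\hat\gamma^{(\hbar)}_r(p)=\frac{\sinh(\frac p2(\frac\pi\hbar-r))}{\sinh(\frac{p\pi}{2\hbar})}$; for $\hbar=0$ and $r>0$, $\gamma^{(0)}_r(\lambda)=\frac{4r}{4\lambda^2+r^2}$, with $\hat\gamma^{(0)}_r(p)=e^{-r|p|/2}$; degenerate cases: $\gamma^{(\hbar)}_0=2\pi\delta$ ($\hat\gamma^{(\hbar)}_0=1$) and $\gamma^{(\hbar)}_{\pi/\hbar}=0$ ($\hat\gamma^{(\hbar)}_{\pi/\hbar}=0$).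 The function $\kappa^{(\hbar)}_r$ (for $0\le r\le\pi/\hbar$, resp. $r\ge 0$ when $\hbar=0$) is defined by its Fourier transform $\hat\kappa^{(\hbar)}_r(p)=\frac{\hat\gamma^{(\hbar)}_r(p)}{2\cosh(p/2)}$. For a positive integer $p$ and $m\in\frac12\mathbb Z_{>0}$, $\Psi^{(m)}_p(\lambda)=\sum_{\alpha=-m+\frac12}^{m-\frac12}f_{\alpha+\frac p2}(\lambda)$ (sum over $\alpha\in\{-m+\frac12,\dots,m-\frac12\}$ in steps of $1$), where $f_x(\lambda)=\frac{2x}{\lambda^2+x^2}$ for $x\ne0$ and $f_0\equiv0$. Terms with an empty range of summation are zero (e.g. all terms involving $\mathcal D_0$ or $\mathcal D_{\mathcal L+1}$). *)

(* Defs.v *)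
From HB Require Import structures.
From mathcomp Require Import all_boot all_order all_algebra.
From mathcomp Require Import all_classical all_reals all_analysis.
Set Implicit Arguments. Unset Strict Implicit. Unset Printing Implicit Defensive.
Import Order.TTheory GRing.Theory Num.Theory.
Import numFieldNormedType.Exports.
Local Open Scope classical_set_scope.
Local Open Scope ring_scope.

Section Defs.
Variable R : realType.

Definition rcosh (x : R) : R := (expR x + expR (- x)) / 2.
Definition rsinh (x : R) : R := (expR x - expR (- x)) / 2.

Definition Rint (f : R -> R) : R := \int[@lebesgue_measure R]_x f x.

(* gamma^{(hb)}_r (lambda), non-degenerate cases (0 < r < pi/hb, or hb = 0, r > 0) *)
Definition gammaf (hb r x : R) : R :=
  if hb == 0 then 4 * r / (4 * x ^+ 2 + r ^+ 2)
  else 2 * hb * sin (hb * r) / (rcosh (2 * hb * x) - cos (hb * r)).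

(* Fourier transform of gamma^{(hb)}_r, hat f(p) = 1/(2pi) int e^{ip l} f(l) dl;
   covers the degenerate cases r = 0 (value 1) and r = pi/hb (value 0);
   at p = 0 (hb > 0) we take the continuous extension. *)
Definition gammahat (hb r p : R) : R :=
  if hb == 0 then expR (- (r * `|p|) / 2)
  else if p == 0 then (pi / hb - r) / (pi / hb)
  else rsinh (p / 2 * (pi / hb - r)) / rsinh (p * pi / (2 * hb)).

Definition kappahat (hb r p : R) : R := gammahat hb r p / (2 * rcosh (p / 2)).

(* kappa^{(hb)}_r = inverse Fourier transform of kappahat:
   kappa(l) = int e^{-ip l} kappahat(p) dp = int cos(p l) kappahat(p) dp
   (kappahat is even in p). *)
Definition kappa (hb r x : R) : R := Rint (fun p => cos (p * x) * kappahat hb r p).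

Definition ff (x l : R) : R := if x == 0 then 0 else 2 * x / (l ^+ 2 + x ^+ 2).

(* Psi^{(m)}_p with m = k/2 (k = 2m), alpha = -m + 1/2 + i, i < 2m;
   alpha + p/2 = (p + 1 + 2 i - k)/2 *)
Definition Psi (k p : nat) (l : R) : R :=
  \sum_(i < k) ff (((p + 1 + 2 * i)%:R - k%:R) / 2) l.

(* Data of the excited state:
   L : number of sea spins; sb j = 2 * sbar_j (1 <= j <= L);
   D j : number of holes in sea j (1 <= j <= L); lth j d = tilde lambda_{j,d+1};
   nu : seq nat, nth 0 nu k = tilde nu_m for m = k/2; lam k l = lambda_{m,l+1}. *)
Variables (L : nat) (sb : nat -> nat) (D : nat -> nat) (lth : nat -> nat -> R)
          (nu : seq nat) (lam : nat -> nat -> R).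

Definition s2 (j : nat) : nat := if j == 0 then 0 else sb j.
Definition Dz (j : nat) : nat := if (j == 0) || (L < j)%N then 0 else D j.
(* hbar_j = pi / (2 (sbar_{j+1} - sbar_j)), hbar_L = 0 *)
Definition hbar (j : nat) : R :=
  if (j < L)%N then pi / ((s2 j.+1)%:R - (s2 j)%:R) else 0.
(* k = 2m belongs to R_j = ]sbar_j, sbar_{j+1}[ (sbar_{L+1} = infinity) *)
Definition inRj (j k : nat) : bool := ((s2 j < k) && ((L <= j) || (k < s2 j.+1)))%N.
Definition nuk (k : nat) : nat := nth 0 nu k.

(* regular (non-delta) part of r_{sbar_j} *)
Definition rreg (j : nat) (x : R) : R :=
  (2 * pi)^-1 *
  (\sum_(d < Dz j.-1)
      kappa (hbar j.-1) ((s2 j)%:R - (s2 j.-1)%:R - 1) (x - lth j.-1 d)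
   + \sum_(d < Dz j.+1)
      kappa (hbar j) ((s2 j.+1)%:R - (s2 j)%:R - 1) (x - lth j.+1 d)
   + \sum_(d < Dz j)
      (kappa (hbar j) 1 (x - lth j d) + kappa (hbar j.-1) 1 (x - lth j d))).

Definition cfun (j : nat) (x : R) : R :=
  - (2 * pi)^-1 * \sum_(k < size nu | inRj j.-1 k) \sum_(l < nuk k)
        gammaf (hbar j.-1) ((s2 j)%:R - k%:R) (x - lam k l)
  - (2 * pi)^-1 * \sum_(k < size nu | inRj j k) \sum_(l < nuk k)
        gammaf (hbar j) (k%:R - (s2 j)%:R) (x - lam k l).

(* int (r_{sbar_j} + c_{sbar_j}) phi, where the term
   (1/2pi) * (-2pi delta(l - lth j d)) of r_{sbar_j} acts by evaluation. *)
Definition pairing_rc (j : nat) (phi : R -> R) : R :=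
  Rint (fun x => (rreg j x + cfun j x) * phi x) - \sum_(d < Dz j) phi (lth j d).

(* Delta E^{(s)}, with p = 2 s *)
Definition DeltaE (p : nat) : R :=
  - (\sum_(1 <= j < L.+1) pairing_rc j (Psi (s2 j) p))
  - \sum_(j < L.+1) \sum_(k < size nu | inRj j k) \sum_(l < nuk k) Psi k p (lam k l).

End Defs.

(* Main.v *)
Require Import Defs.
From HB Require Import structures.
From mathcomp Require Import all_boot all_order all_algebra.
From mathcomp Require Import all_classical all_reals all_analysis.
From mathcomp Require Import measurable_realfun zify ring lra.
Import Order.TTheory GRing.Theory Num.Theory.
Import numFieldNormedType.Exports.
Set Implicit Arguments.
Unset Strict Implicit.
Local Open Scope classical_set_scope.
Local Open Scope ring_scope.

(** In Fourier space the theorem is a discrete Green's function computation.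
    The transform U_k of Psi^(k/2)_p satisfies
    U_(k+1) + U_(k-1) - 2 cosh(q/2) U_k = - [k = p], and the transforms of the
    strip kernels gamma interpolate solutions of the homogeneous equation between
    two consecutive sea spins. Strings therefore contribute nothing, and a hole in
    sea j contributes [2 sbar_j = p] / (2 cosh(q/2)), the transform of
    pi / cosh(pi x).

    Two Fourier pairs have to be established by real methods. The integral of
    cos(qx) 2y/(x^2+y^2) follows from that of cos(px) exp(-y|p|) by exponential
    damping, Fubini and an approximate identity. The strip kernel of width n is
    handled by Herglotz's trick: both it and its Fourier integral satisfy
    X(n,r) = X(2n,r) - X(2n,2n-r), and they differ by O(r/n^2). *)

(* [Rint] is also a ring qualifier in mathcomp. *)
Local Notation Rint := Defs.Rint.

(** The recurrence explains the parameters of the kernels. With k = 2 sbar_j, the numbers 1 and gap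
    - 1 are the distances of k + 1 and k - 1 to the ends of the two intervals meeting at k, so the
    four kappa terms of a hole in sea j add up to (U_(k+1) + U_(k-1)) / (2 cosh(q/2)). The delta
    term subtracts U_k, and only the source of the recurrence is left. Interpolation over an
    interval would fail if the source lay strictly inside it; this cannot happen, because p is twice
    a sea spin. At both ends of the chain of seas the conventions are built into U: it vanishes at k
    = 0, and beyond the source it is a multiple of exp(-k|q|/2), which the rational kernel for hbar
    = 0 propagates. The energy is a sum over seas, each receiving terms from its neighbours, whereas
    the cancellations happen excitation by excitation, so the last step is a reindexing. All kernels
    are even, hence cosine integrals suffice. The recurrence and the interpolation come from
    cancelling sinh(|q|/2) and are stated for nonzero q. *)

(** * Integrals over the real line: linearity, half-line primitives, Fubini *)

Section IntegralsOverR.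
Variable R : realType.
Implicit Types f g h : R -> R.
Local Notation mu := (@lebesgue_measure R).

Definition integrableR f : Prop := mu.-integrable setT (EFin \o f).

(** [Rint] is total and says nothing about convergence; bundling integrability with the value lets
    both pass together through linear combinations. *)
Definition has_int f (v : R) : Prop := integrableR f /\ Rint f = v.

Lemma integrableR_measurable f : integrableR f -> measurable_fun setT f.
Proof. by move=> /integrableP[/measurable_EFinP]. Qed.

Lemma integrableRE f : integrableR f -> (\int[mu]_x (f x)%:E)%E = (Rint f)%:E.
Proof. by move=> fi; rewrite /Rint /Rintegral fineK//; exact: integrable_fin_num. Qed.

Lemma le_integrableR f g : measurable_fun setT f -> integrableR g ->
  (forall x, `|f x| <= g x) -> integrableR f.
Proof.
move=> mf gi fg; apply: le_integrable gi => //; first exact/measurable_EFinP.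
by move=> x _; rewrite /= lee_fin (le_trans (fg x)) ?ler_norm.
Qed.

Lemma has_int_ext f g v : (forall x, f x = g x) -> has_int f v -> has_int g v.
Proof. by move=> /funext ->. Qed.

Lemma has_int_add f g u v : has_int f u -> has_int g v ->
  has_int (fun x => f x + g x) (u + v).
Proof.
move=> [fi fu] [gi gv]; split.
  by have := integrableD measurableT fi gi; apply: eq_integrable.
by rewrite /Rint RintegralD// -fu -gv.
Qed.

Lemma has_int_scale f k v : has_int f v -> has_int (fun x => k * f x) (k * v).
Proof.
move=> [fi fv]; split.
  by have := integrableZl measurableT k fi; apply: eq_integrable.
by rewrite /Rint RintegralZl// -fv.
Qed.

Lemma has_int_sub f g u v : has_int f u -> has_int g v ->
  has_int (fun x => f x - g x) (u - v).
Proof.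
move=> fu /(has_int_scale (-1)) gv; have := has_int_add fu gv.
by rewrite mulN1r; apply: has_int_ext => x; rewrite mulN1r.
Qed.

Lemma has_int0 : has_int (fun=> 0) 0.
Proof.
split; first exact: integrable0.
by rewrite /Rint Rintegral_cst// mul0r.
Qed.

Lemma has_int_sum (I : Type) (s : seq I) (P : pred I) (F : I -> R -> R) V :
  (forall i, P i -> has_int (F i) (V i)) ->
  has_int (fun x => \sum_(i <- s | P i) F i x) (\sum_(i <- s | P i) V i).
Proof.
move=> FV; elim: s => [|i s IH].
  by rewrite big_nil; apply: has_int_ext has_int0 => x; rewrite big_nil.
rewrite big_cons; case: ifP => Pi.
  by apply: has_int_ext (has_int_add (FV _ Pi) IH) => x; rewrite big_cons Pi.
by apply: has_int_ext IH => x; rewrite big_cons Pi.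
Qed.

(** Transforms are compared after cancelling a factor that vanishes at 0, hence only off 0; the
    integral does not see that null point. [g] inherits measurability as [f] patched at one
    point. *)
Lemma has_int_off0 f g v : (forall x, x != 0 -> f x = g x) ->
  has_int f v -> has_int g v.
Proof.
move=> fg [fi fv].
have mf := integrableR_measurable fi.
have mg : measurable_fun setT g.
  rewrite (_ : g = fun x => if x == 0 then g 0 else f x); last first.
    by apply/funext => x; case: eqVneq => [->|/fg ->].
  apply: measurable_fun_ifT => //.
  by apply: measurable_fun_eqr => //; exact: measurable_cst.
have mD : measurable ([set: R] `\ 0) by exact: measurableD.
have fgE (F : R -> \bar R) (G : R -> \bar R) :
    measurable_fun setT F -> measurable_fun setT G ->
    (forall x, x != 0 -> F x = G x) ->
    (\int[mu]_x F x = \int[mu]_x G x)%E.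
  move=> mF mG FG; rewrite -(@integral_setD1 _ F 0)//; last exact: measurable_funTS.
  rewrite -(@integral_setD1 _ G 0)//; last exact: measurable_funTS.
  by apply: eq_integral => x /set_mem[_ /= /eqP x0]; exact: FG.
split.
  apply/integrableP; split; first exact/measurable_EFinP.
  case/integrableP: fi => mf'; rewrite (fgE _ (fun x => `|(EFin \o g) x|%E))//.
  - exact: measurableT_comp.
  - by apply: measurableT_comp => //; exact/measurable_EFinP.
  - by move=> x x0 /=; rewrite fg.
rewrite -fv /Rint /Rintegral; congr fine; apply/esym/fgE; try exact/measurable_EFinP.
by move=> x x0; rewrite fg.
Qed.

Lemma le_has_int f g u v : has_int f u -> has_int g v ->
  (forall x, f x <= g x) -> u <= v.
Proof. by move=> [fi <-] [gi <-] fg; apply: le_Rintegral => // x _. Qed.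

Lemma has_int_norm f g u v : has_int f u -> has_int g v ->
  (forall x, `|f x| <= g x) -> `|u| <= v.
Proof.
move=> fu gv fg; rewrite ler_norml; apply/andP; split; last first.
  by apply: (le_has_int fu gv) => x; apply: le_trans (fg x); exact: ler_norm.
have := has_int_scale (-1) gv; rewrite mulN1r => gv'.
apply: (le_has_int gv' fu) => x; rewrite mulN1r lerNl.
by apply: le_trans (fg x); rewrite -normrN ler_norm.
Qed.

Lemma measurable_invr : measurable_fun [set: R] (@GRing.inv R).
Proof.
rewrite (_ : GRing.inv = fun x : R => if x == 0 then 0 else x^-1); last first.
  by apply/funext => x; case: eqP => // ->; rewrite invr0.
apply: measurable_fun_if => //.
- by apply: measurable_fun_eqr => //; exact: measurable_cst.
- rewrite setTI (_ : _ @^-1` _ = [set x : R | x != 0]); last first.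
    by apply/seteqP; split => x /=; case: eqP.
  apply: open_continuous_measurable_fun.
    rewrite (_ : [set x | _] = ~` [set 0]); last first.
      by apply/seteqP; split => x /= /eqP.
    by rewrite openC; exact: closed_eq.
  by move=> x; rewrite inE /= => x0; exact: inv_continuous.
Qed.

Lemma ge0_has_intP f v : (forall x, 0 <= f x) -> measurable_fun setT f ->
  (\int[mu]_x (f x)%:E = v%:E)%E -> has_int f v.
Proof.
move=> f0 mf fv; split; last by rewrite /Rint /Rintegral fv.
apply/integrableP; split; first exact/measurable_EFinP.
rewrite (_ : (fun x => `|(EFin \o f) x|%E) = EFin \o f); last first.
  by apply/funext => x /=; rewrite ger0_norm.
by rewrite fv ltry.
Qed.

(** Agreement of [dF] with [f] is asked on the positive half-line only, so that [f] may contain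
    [|x|] while [F] and [dF] are smooth formulas. *)
Lemma has_int_even f (F dF : R -> R) (l : R) :
  (forall x, 0 <= f x) -> continuous f -> (forall x, f (- x) = f x) ->
  F x @[x --> +oo%R] --> l ->
  (forall x : R, is_derive x (1 : R) F (dF x)) ->
  (forall x, 0 < x -> dF x = f x) ->
  has_int f (2 * (l - F 0)).
Proof.
move=> f0 cf fN Fl FdF dFE.
apply: ge0_has_intP => //; first exact: continuous_measurable_fun.
rewrite ge0_symfun_integralT//.
rewrite (_ : [set x | _] = `[0, +oo[%classic); last first.
  by apply/seteqP; split => x/=; rewrite in_itv/= andbT.
rewrite (@ge0_continuous_FTC2y _ f F 0 l)//.
- by apply: continuous_subspaceT.
- apply: cvg_at_right_filter; apply/differentiable_continuous/derivable1_diffP.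
  by case: (FdF 0).
- by move=> x; rewrite in_itv /= andbT => /dFE <-; rewrite derive1E; case: (FdF x).
- by move=> x; rewrite /= fN.
Qed.

Lemma has_int_opp f v : (forall x, 0 <= f x) -> continuous f ->
  has_int f v -> has_int (f \o -%R) v.
Proof.
move=> f0 cf [fi fv].
have cfN : continuous (f \o -%R).
  by move=> x; apply: continuous_comp; [exact: opp_continuous|exact: cf].
have split (g : R -> R) : (forall x, 0 <= g x) -> continuous g ->
  (\int[mu]_x (g x)%:E = \int[mu]_(x in `[0%R, +oo[) (g x)%:E
     + \int[mu]_(x in `[0%R, +oo[) ((g \o -%R) x)%:E)%E.
  move=> g0 cg; have mg : measurable_fun setT g by exact: continuous_measurable_fun.
  rewrite -(setUv `[0%R, +oo[) ge0_integral_setU//=; last 4 first.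
  - by apply/measurableC.
  - by apply/measurable_EFinP; rewrite setUv.
  - by move=> x _; rewrite lee_fin.
  - exact/disj_setPCl.
  congr (_ + _)%E; rewrite setCitvr.
  rewrite integral_itv_bndo_bndc; last exact/measurable_EFinP/measurable_funTS.
  rewrite -{1}oppr0 ge0_integration_by_substitutionNy//.
  exact: continuous_subspaceT.
apply: ge0_has_intP => [x||]; first exact: f0.
  exact: continuous_measurable_fun.
rewrite -fv -integrableRE// split//; last by move=> x; exact: f0.
rewrite (split f)// addeC; congr (_ + _)%E.
by apply: eq_integral => x _ /=; rewrite opprK.
Qed.

(** Since [K] is bounded by 1, the integrand is dominated by |f(x)| |gh(q)|, so Tonelli gives
    integrability on the product. The inner integral enters as [phi] because it is known in closed
    form at each use. *)
Lemma has_int_fubini (K : R * R -> R) (gh f : R -> R) (phi : R -> R) :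
  measurable_fun setT K -> (forall z, `|K z| <= 1) ->
  integrableR gh -> integrableR f ->
  (forall q, Rint (fun x => K (x, q) * f x) = phi q) ->
  has_int (fun x => Rint (fun q => K (x, q) * gh q) * f x)
          (Rint (fun q => phi q * gh q)) /\ integrableR (fun q => phi q * gh q).
Proof.
move=> mK K1 ghi fi phiE.
have mgh := integrableR_measurable ghi; have mf := integrableR_measurable fi.
pose F (z : R * R) : \bar R := (K z * gh z.2 * f z.1)%:E.
have mF : measurable_fun setT F.
  apply/measurable_EFinP; apply: measurable_funM; first apply: measurable_funM => //.
    exact: (measurableT_comp mgh measurable_snd).
  exact: (measurableT_comp mf measurable_fst).
have Kx x : measurable_fun setT (fun q => K (x, q)) by exact: measurableT_comp.
have Kq q : measurable_fun setT (fun x => K (x, q)) by exact: measurableT_comp.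
have iKg x : integrableR (fun q => K (x, q) * gh q).
  apply: (@le_integrableR _ (fun q => `|gh q|)).
  - exact: measurable_funM.
  - exact: integrable_norm.
  - by move=> q; rewrite normrM ler_piMl.
have iKf q : integrableR (fun x => K (x, q) * f x).
  apply: (@le_integrableR _ (fun q => `|f q|)).
  - exact: measurable_funM.
  - exact: integrable_norm.
  - by move=> x; rewrite normrM ler_piMl.
have iF : (mu \x mu)%E.-integrable setT F.
  apply/integrable12ltyP => //.
  have ing : integrableR (fun q => `|gh q|) by exact: integrable_norm.
  have inf : integrableR (fun q => `|f q|) by exact: integrable_norm.
  have B : has_int (fun x => Rint (fun q => `|gh q|) * `|f x|)
     (Rint (fun q => `|gh q|) * Rint (fun x => `|f x|)) by exact: has_int_scale.
  apply: (@le_lt_trans _ _ (\int[mu]_x (Rint (fun q => `|gh q|) * `|f x|)%:E)%E); last first.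
    by rewrite integrableRE ?ltry//; case: B.
  apply: ge0_le_integral => //.
  - by move=> x _; exact: integral_ge0.
  - apply: (@measurable_fun_fubini_tonelli_F _ _ _ _ _ mu (abse \o F)) => //=.
    exact: measurableT_comp.
  - by case/integrableP: B.1.
  move=> x _; rewrite mulrC.
  have [i1 e1] : has_int (fun q => `|f x| * `|gh q|) (`|f x| * Rint (fun q => `|gh q|)).
    exact: has_int_scale.
  rewrite -e1 -integrableRE//; apply: ge0_le_integral => //.
  - by apply: measurableT_comp => //; exact: measurableT_comp.
  - by case/integrableP: i1.
  by move=> q _ /=; rewrite lee_fin !normrM/= mulrC ler_wpM2l// ler_piMl.
have FE x : (\int[mu]_q F (x, q))%E = (Rint (fun q => K (x, q) * gh q) * f x)%:E.
  have [i1 e1] : has_int (fun q => f x * (K (x, q) * gh q)) (f x * Rint (fun q => K (x, q) * gh q)).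
    exact: has_int_scale.
  by rewrite mulrC -e1 -integrableRE//; apply: eq_integral => q _; rewrite /F/= mulrC.
have GE q : (\int[mu]_x F (x, q))%E = (phi q * gh q)%:E.
  have [i1 e1] : has_int (fun x => gh q * (K (x, q) * f x)) (gh q * Rint (fun x => K (x, q) * f x)).
    exact: has_int_scale.
  rewrite mulrC -phiE -e1 -integrableRE//; apply: eq_integral => x _.
  by rewrite /F/= mulrCA mulrA.
have i1 := integrable_fubini_F iF.
rewrite /fubini_F (funext FE) in i1.
have i2 : mu.-integrable setT (fun q => (phi q * gh q)%:E).
  apply/integrableP; split.
    by rewrite -(funext GE); exact: measurable_fubini_G iF.
  have := (@integrable21ltyP _ _ _ _ _ mu mu F mF).1 iF.
  apply: le_lt_trans; apply: ge0_le_integral => //.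
  - apply: measurableT_comp => //; rewrite -(funext GE); exact: measurable_fubini_G iF.
  - apply: (@measurable_fun_fubini_tonelli_G _ _ _ _ _ mu (abse \o F)) => //=.
    exact: measurableT_comp.
  by move=> q _; rewrite -GE; apply: le_abse_integral => //; exact: measurableT_comp.
split=> //; split=> //.
rewrite /Rint /Rintegral; congr fine.
transitivity (\int[mu]_x \int[mu]_q F (x, q))%E.
  by apply: eq_integral => x _; rewrite FE.
by rewrite Fubini//; apply: eq_integral => q _; rewrite GE.
Qed.

End IntegralsOverR.

(** * Derivatives computed by syntax, and inequalities obtained by integrating them *)

Section RealDerivatives.
Variable R : realType.
Implicit Types (f g : R -> R) (x a b : R).

Lemma is_derive_cast f x a b : is_derive x (1 : R) f a -> a = b ->
  is_derive x (1 : R) f b.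
Proof. by move=> ? <-. Qed.

Lemma is_derive_cstR (c : R) x : is_derive x (1 : R) (fun=> c) (0 : R).
Proof. exact: is_derive_cst. Qed.

Lemma is_derive_idR x : is_derive x (1 : R) (fun t => t) (1 : R).
Proof. exact: is_derive_id. Qed.

Lemma is_derive_addR f g x a b : is_derive x (1 : R) f a -> is_derive x (1 : R) g b ->
  is_derive x (1 : R) (fun t => f t + g t) (a + b).
Proof. by move=> *; exact: is_deriveD. Qed.

Lemma is_derive_oppR f x a : is_derive x (1 : R) f a ->
  is_derive x (1 : R) (fun t => - f t) (- a).
Proof. by move=> *; exact: is_deriveN. Qed.

Lemma is_derive_mulR f g x a b : is_derive x (1 : R) f a -> is_derive x (1 : R) g b ->
  is_derive x (1 : R) (fun t => f t * g t) (f x * b + g x * a).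
Proof. by move=> *; exact: is_deriveM. Qed.

Lemma is_derive_compR f g x a b : is_derive (g x) (1 : R) f a -> is_derive x (1 : R) g b ->
  is_derive x (1 : R) (fun t => f (g t)) (a * b).
Proof. by move=> *; exact: is_derive1_comp. Qed.

Lemma is_derive_exprR f n x a : is_derive x (1 : R) f a ->
  is_derive x (1 : R) (fun t => f t ^+ n.+1) (n.+1%:R * f x ^+ n * a).
Proof.
move=> fa; elim: n => [|n IH].
  by apply: is_derive_cast fa _; rewrite expr0 !mul1r.
rewrite (_ : (fun t => _) = (fun t => f t * f t ^+ n.+1)); last first.
  by apply/funext => t; rewrite exprS.
apply: is_derive_cast (is_derive_mulR fa IH) _.
by rewrite -[in RHS]natr1 !exprS; ring.
Qed.

Lemma is_derive_expRR f x a : is_derive x (1 : R) f a ->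
  is_derive x (1 : R) (fun t => expR (f t)) (expR (f x) * a).
Proof. by move=> fa; apply: is_derive_compR fa; exact: is_derive_expR. Qed.

Lemma is_derive_cosR f x a : is_derive x (1 : R) f a ->
  is_derive x (1 : R) (fun t => cos (f t)) (- sin (f x) * a).
Proof. by move=> fa; apply: is_derive_compR fa; exact: is_derive_cos. Qed.

Lemma is_derive_sinR f x a : is_derive x (1 : R) f a ->
  is_derive x (1 : R) (fun t => sin (f t)) (cos (f x) * a).
Proof. by move=> fa; apply: is_derive_compR fa; exact: is_derive_sin. Qed.

Lemma is_derive_atanR f x a : is_derive x (1 : R) f a ->
  is_derive x (1 : R) (fun t => atan (f t)) ((1 + f x ^+ 2)^-1 * a).
Proof. by move=> fa; apply: is_derive_compR fa; exact: is_derive1_atan. Qed.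

Lemma is_derive_continuous f (df : R -> R) :
  (forall x, is_derive x (1 : R) f (df x)) -> continuous f.
Proof.
move=> fdf x; apply/differentiable_continuous/derivable1_diffP.
by case: (fdf x).
Qed.

(** Iterating this yields all the Taylor bounds for sin, cos, sinh and cosh below. The bound [B]
    serves the estimates that hold on a bounded interval only. *)
Lemma derive_ge0_ge0 f (df : R -> R) B :
  (forall x, is_derive x (1 : R) f (df x)) -> f 0 = 0 ->
  (forall x, 0 <= x <= B -> 0 <= df x) -> forall x, 0 <= x <= B -> 0 <= f x.
Proof.
move=> fdf f0 df0 x /andP[x0 xB].
have [c] := @MVT_segment _ f df 0 x x0 (fun y _ => fdf y)
  (continuous_subspaceT (is_derive_continuous fdf)).
rewrite in_itv /= f0 !subr0 => /andP[c0 cx] ->.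
by rewrite mulr_ge0// df0// c0 (le_trans cx).
Qed.

End RealDerivatives.

(** The derivative is an evar filled during the descent through the body. [notypeclasses refine]
    keeps the premises as goals instead of passing them to instance search, and the power rule is
    tried on literal powers only. *)
Ltac isd := first [ notypeclasses refine (is_derive_cstR _ _)
  | notypeclasses refine (is_derive_idR _)
  | lazymatch goal with
    | |- is_derive _ _ (fun t => @?f t ^+ _) _ =>
        notypeclasses refine (is_derive_exprR _ _); isd
    end
  | notypeclasses refine (is_derive_addR _ _); isd
  | notypeclasses refine (is_derive_oppR _); isd
  | notypeclasses refine (is_derive_expRR _); isd
  | notypeclasses refine (is_derive_cosR _); isd
  | notypeclasses refine (is_derive_sinR _); isd
  | notypeclasses refine (is_derive_atanR _); isd
  | notypeclasses refine (is_derive_mulR _ _); isd ].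

Ltac derive_to := notypeclasses refine (is_derive_cast _ _); [isd|cbv beta].

(** * The Poisson kernel as cosine transform of exp(-y|p|) *)

Section PoissonKernel.
Variable R : realType.
Implicit Types (x y p q d : R).

Lemma cvgy_expRN y : 0 < y -> expR (- (y * p)) @[p --> +oo%R] --> (0 : R).
Proof.
move=> y0; have : (fun p => y * p) p @[p --> +oo%R] --> +oo%R.
  apply/cvgryPge => A; exists (y^-1 * A).
  by split; [exact: num_real|move=> p /ltW; rewrite ler_pdivrMl].
by move=> h; exact: (cvg_comp _ _ h (@cvgr_expR R)).
Qed.

Lemma cvgy_le_expRN (F : R -> R) C y : 0 < y ->
  (forall p, `|F p| <= C * expR (- (y * p))) -> F p @[p --> +oo%R] --> (0 : R).
Proof.
move=> y0 FC; have h : C * expR (- (y * p)) @[p --> +oo%R] --> (0 : R).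
  by rewrite -(mulr0 C); apply: cvgM (cvgy_expRN y0); exact: cvg_cst.
have h' : - (C * expR (- (y * p))) @[p --> +oo%R] --> (0 : R).
  by rewrite -oppr0; exact: cvgN h.
by apply: squeeze_cvgr h' h; apply: nearW => p; rewrite -ler_norml.
Qed.

Lemma continuous_expabs y : continuous (fun p : R => expR (- (y * `|p|))).
Proof.
move=> p; apply: continuous_comp; last exact: continuous_expR.
by apply: cvgN; apply: cvgM; [exact: cvg_cst|exact: norm_continuous].
Qed.

Lemma has_int_expabs y : 0 < y -> has_int (fun p : R => expR (- (y * `|p|))) (2 / y).
Proof.
move=> y0.
pose F p := - (y^-1 * expR (- (y * p))).
have -> : 2 / y = 2 * (0 - F 0).
  by rewrite /F mulr0 oppr0 expR0; field; rewrite gt_eqF.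
apply: (@has_int_even _ _ F (fun p => expR (- (y * p)))).
- by move=> p; exact: expR_ge0.
- exact: continuous_expabs.
- by move=> p; rewrite normrN.
- apply: (@cvgy_le_expRN _ y^-1 y) => // p.
  by rewrite normrN ger0_norm// mulr_ge0 ?expR_ge0// invr_ge0 ltW.
- by move=> p; rewrite /F; derive_to; field; rewrite gt_eqF.
- by move=> p p0; rewrite gtr0_norm.
Qed.

Lemma ffE y x : 0 < y -> ff y x = 2 * y / (x ^+ 2 + y ^+ 2).
Proof. by move=> y0; rewrite /ff gt_eqF. Qed.

Lemma sqrDsqr_gt0 y x : 0 < y -> 0 < x ^+ 2 + y ^+ 2.
Proof. by move=> y0; rewrite ltr_wpDl ?sqr_ge0// exprn_gt0. Qed.

Lemma has_int_cos_expabs y x : 0 < y ->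
  has_int (fun p => cos (p * x) * expR (- (y * `|p|))) (ff y x).
Proof.
move=> y0; rewrite ffE//; have y0' : y != 0 by rewrite gt_eqF.
have xy0 := sqrDsqr_gt0 x y0.
have xy0' : x ^+ 2 + y ^+ 2 != 0 by rewrite gt_eqF.
pose F p := (x ^+ 2 + y ^+ 2)^-1 * (expR (- (y * p)) * (x * sin (p * x) - y * cos (p * x)))
   - y^-1 * expR (- (y * p)).
(* The half-line rule asks for a nonnegative integrand, so 1 + cos is integrated and the plain
   exponential is subtracted afterwards; the last term of [F] is the primitive of that
   exponential. *)
have H : has_int (fun p => (1 + cos (p * x)) * expR (- (y * `|p|))) (2 * (0 - F 0)).
  apply: (@has_int_even _ _ F (fun p => (1 + cos (p * x)) * expR (- (y * p)))).
  - by move=> p; rewrite mulr_ge0 ?expR_ge0//; have := cos_geN1 (p * x); lra.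
  - move=> p; apply: cvgM; last exact: continuous_expabs.
    apply: (is_derive_continuous (f := fun p => 1 + cos (p * x))
      (df := fun p => - sin (p * x) * x)) => t.
    by derive_to; ring.
  - by move=> p; rewrite normrN mulNr cosN.
  - apply: (@cvgy_le_expRN _ ((x ^+ 2 + y ^+ 2)^-1 * (`|x| + y) + y^-1) y) => // p.
    rewrite /F (le_trans (ler_normB _ _))// mulrDl lerD//; last first.
      by rewrite ger0_norm// mulr_ge0 ?expR_ge0// invr_ge0 ltW.
    rewrite !normrM ger0_norm ?invr_ge0 ?(ltW xy0)// -mulrA ler_wpM2l ?invr_ge0 ?(ltW xy0)//.
    rewrite ger0_norm ?expR_ge0// mulrC ler_wpM2r ?expR_ge0//.
    rewrite (le_trans (ler_normB _ _))// !normrM (gtr0_norm y0) lerD//.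
      by rewrite ler_piMr// sin_max.
    by rewrite ler_piMr ?(ltW y0)// cos_max.
  - by move=> p; rewrite /F; derive_to; field; rewrite y0' xy0'.
  - by move=> p p0; rewrite gtr0_norm.
have := has_int_sub H (has_int_expabs y0).
have -> : 2 * (0 - F 0) - 2 / y = 2 * y / (x ^+ 2 + y ^+ 2).
  by rewrite /F !(mulr0, mul0r) oppr0 expR0 sin0 cos0; field; rewrite y0' xy0'.
by apply: has_int_ext => p; ring.
Qed.

Lemma ff_ge0 y x : 0 < y -> 0 <= ff y x.
Proof.
by move=> y0; rewrite ffE// mulr_ge0 ?invr_ge0 ?(ltW (sqrDsqr_gt0 x y0))// mulr_ge0 ?ltW.
Qed.

Lemma ffNr y x : ff y (- x) = ff y x.
Proof. by rewrite /ff sqrrN. Qed.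

Lemma continuous_ff y : 0 < y -> continuous (ff y).
Proof.
move=> y0; rewrite (_ : ff y = fun x => 2 * y / (x ^+ 2 + y ^+ 2)); last first.
  by apply/funext => x; rewrite ffE.
move=> x; apply: cvgM; first exact: cvg_cst.
apply: cvgV; first by rewrite gt_eqF// sqrDsqr_gt0.
by apply: cvgD; [exact: exprn_continuous|exact: cvg_cst].
Qed.

(** The sum over q and -q is even in p, as the half-line rule requires; it is also the combination
    that cos(px) cos(qx) produces under exponential damping. *)
Lemma has_int_ff_shifts d q : 0 < d ->
  has_int (fun p => ff d (p - q) + ff d (p + q)) (4 * pi).
Proof.
move=> d0; have d0' : d != 0 by rewrite gt_eqF.
pose F p := 2 * atan (d^-1 * (p - q)) + 2 * atan (d^-1 * (p + q)).
have -> : 4 * pi = 2 * (2 * pi - F 0).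
  rewrite /F !add0r mulrN atanN; ring.
have cs (c : R) : continuous (fun p => ff d (p + c)).
  move=> p; apply: (@continuous_comp R R R (fun p => p + c) (ff d)); last exact: continuous_ff.
  by apply: cvgD; [exact: cvg_id|exact: cvg_cst].
have cvs (c : R) : 2 * atan (d^-1 * (p + c)) @[p --> +oo%R] --> (pi : R).
  rewrite (_ : pi = 2 * (pi / 2)); last by field.
  apply: cvgM; first exact: cvg_cst.
  have : (fun p => d^-1 * (p + c)) p @[p --> +oo%R] --> +oo%R.
    apply/cvgryPge => A; exists (d * A - c).
    split; first exact: num_real.
    by move=> p /ltW; rewrite lerBlDr -ler_pdivlMl.
  by move=> h; exact: (cvg_comp _ _ h (@cvgy_atan R)).
apply: (@has_int_even _ _ F (fun p => ff d (p - q) + ff d (p + q))) => //.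
- by move=> p; rewrite addr_ge0// ff_ge0.
- by move=> p; apply: cvgD; exact: cs.
- by move=> p; rewrite -opprD ffNr (_ : - p + q = - (p - q)) ?ffNr; [rewrite addrC|ring].
- by rewrite (_ : 2 * pi = pi + pi); [apply: cvgD; exact: cvs|ring].
- move=> p; rewrite /F !ffE//; derive_to.
  have h1 := sqrDsqr_gt0 (p - q) d0; have h2 := sqrDsqr_gt0 (p + q) d0.
  field; rewrite d0'/= !gt_eqF//; nra.
Qed.

Lemma has_int_ff y : 0 < y -> has_int (ff y) (2 * pi).
Proof.
move=> y0; have := has_int_scale (2^-1) (has_int_ff_shifts 0 y0).
rewrite (_ : _ * (4 * pi) = 2 * pi); last by field.
by apply: has_int_ext => x; rewrite subr0 addr0; field.
Qed.

End PoissonKernel.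

(** * The transform of the Poisson kernel and Parseval pairings with it *)

Section FourierPairing.
Variable R : realType.
Implicit Types (x y p q d a : R).

Lemma Rint_dominated (F : nat -> R -> R) (f g : R -> R) :
  (forall n, measurable_fun setT (F n)) -> measurable_fun setT f ->
  (forall x, F n x @[n --> \oo] --> f x) -> integrableR g ->
  (forall n x, `|F n x| <= g x) ->
  integrableR f /\ Rint (F n) @[n --> \oo] --> Rint f.
Proof.
move=> mF mf Ff gi Fg.
have mF' n : measurable_fun setT (fun x => (F n x)%:E) by exact/measurable_EFinP.
have mf' : measurable_fun setT (fun x => (f x)%:E) by exact/measurable_EFinP.
have Fi n : integrableR (F n) by exact: le_integrableR gi _.
have h1 : {ae @lebesgue_measure R, forall x, setT x -> (F n x)%:E @[n --> \oo] --> (f x)%:E}.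
  by apply: aeW => x _; apply: cvg_EFin; [exact: nearW|exact: Ff].
have h2 : {ae @lebesgue_measure R, forall x n, setT x -> (`|(F n x)%:E| <= (g x)%:E)%E}.
  by apply: aeW => x n _; rewrite lee_fin.
have [fi _ cv] := @dominated_convergence _ _ _ (@lebesgue_measure R) setT measurableT
  (fun n x => (F n x)%:E) (EFin \o f) (EFin \o g) mF' mf' h1 gi h2.
split=> //; apply: fine_cvg; rewrite -integrableRE//.
Qed.

Lemma expRN_dist (a b : R) : 0 <= a -> 0 <= b ->
  `|expR (- a) - expR (- b)| <= Num.min 1 `|a - b|.
Proof.
wlog ab : a b / a <= b.
  move=> H a0 b0; case: (leP a b) => [/H|/ltW /H]; first exact.
  by rewrite distrC (distrC a); exact.
move=> a0 b0; rewrite distrC (ler0_norm (x := a - b)) ?subr_le0// opprB.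
have e0 := expR_gt0 (- a); have e0' := expR_gt0 (- b).
have e1 : expR (- a) <= 1 by rewrite expR_le1 oppr_le0.
have E : expR (- b) = expR (- a) * expR (a - b) by rewrite -expRD; congr expR; ring.
have := expR_ge1Dx (a - b) => h.
rewrite ler0_norm ?subr_le0 ?ler_expR ?lerN2// opprB le_min; apply/andP; split; first lra.
rewrite E; nra.
Qed.

(** This provides a majorant independent of d for dominated convergence. For |u| <= 1 the bound y|u|
    and 2|u|d <= u^2 + d^2 give at most y; for |u| > 1 the bounds |D| <= 1 and d <= 1 leave at most
    2/u^2. Both lie below the stated multiple of the kernel of width 1. *)
Lemma ff_near_diagonal y d (D u : R) : 0 < y -> 0 < d <= 1 ->
  `|D| <= 1 -> `|D| <= y * `|u| -> `|D * ff d u| <= (y + 2) * ff 1 u.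
Proof.
move=> y0 /andP[d0 d1] D1 Du; rewrite normrM (ger0_norm (ff_ge0 u d0)) !ffE//.
have s1 := sqrDsqr_gt0 u d0; have s2 : 0 < u ^+ 2 + 1 ^+ 2 := sqrDsqr_gt0 u ltr01.
rewrite !mulrA ler_pdivlMr// mulrAC ler_pdivrMr// expr1n !mulr1 -(mulrA `|D|).
have E : u ^+ 2 = `|u| ^+ 2 by rewrite real_normK ?num_real.
rewrite expr1n E in s2; rewrite E in s1 *.
move: D1 Du s1 s2; set v := `|u|; set e := `|D| => D1 Du s1 s2.
have v0 : 0 <= v by exact: normr_ge0.
have e0 : 0 <= e by exact: normr_ge0.
case: (leP v 1) => v1.
  have h1 : e * (2 * d) <= y * (v ^+ 2 + d ^+ 2).
    apply: (@le_trans _ _ (y * v * (2 * d))); first by rewrite ler_wpM2r// mulr_ge0// ltW.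
    rewrite -!mulrA ler_wpM2l ?(ltW y0)//.
    by rewrite -subr_ge0 (_ : _ - _ = (v - d) ^+ 2) ?sqr_ge0//; ring.
  have h2 : v ^+ 2 + 1 <= 2 by nra.
  apply: (@le_trans _ _ (y * (v ^+ 2 + d ^+ 2) * 2)).
    apply: (@le_trans _ _ (y * (v ^+ 2 + d ^+ 2) * (v ^+ 2 + 1))).
      by rewrite ler_wpM2r ?(ltW s2).
    by rewrite ler_wpM2l// mulr_ge0 ?(ltW y0) ?(ltW s1).
  rewrite -subr_ge0; have -> : (y + 2) * 2 * (v ^+ 2 + d ^+ 2) - y * (v ^+ 2 + d ^+ 2) * 2 = 4 * (v ^+ 2 + d ^+ 2) by ring.
  by rewrite mulr_ge0// ltW.
have h1 : e * (2 * d) <= 2 by nra.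
have h2 : v ^+ 2 + 1 <= 2 * v ^+ 2 by nra.
apply: (@le_trans _ _ (2 * (2 * v ^+ 2))).
  apply: (@le_trans _ _ (2 * (v ^+ 2 + 1))); first by rewrite ler_wpM2r ?(ltW s2).
  by rewrite ler_wpM2l.
have h3 : v ^+ 2 <= v ^+ 2 + d ^+ 2 by rewrite lerDl sqr_ge0.
have : 2 * 2 * (v ^+ 2 + d ^+ 2) <= (y + 2) * 2 * (v ^+ 2 + d ^+ 2).
  by rewrite ler_wpM2r ?(ltW s1)//; lra.
lra.
Qed.

Lemma measurable_cosM (a : R) : measurable_fun setT (fun z : R * R => cos (z.2 * (z.1 - a))).
Proof.
apply: (measurableT_comp (f := cos)).
  by apply: continuous_measurable_fun; exact: continuous_cos.
apply: measurable_funM => //; apply: measurable_funB => //.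
Qed.

Lemma measurable_expabs y : measurable_fun setT (fun p : R => expR (- (y * `|p|))).
Proof. exact: continuous_measurable_fun (@continuous_expabs R y). Qed.

Lemma measurable_ff y : 0 < y -> measurable_fun setT (ff y).
Proof. by move=> y0; exact: continuous_measurable_fun (continuous_ff y0). Qed.

Lemma measurable_cosl q : measurable_fun setT (fun x : R => cos (q * x)).
Proof.
apply: (measurableT_comp (f := cos)).
  by apply: continuous_measurable_fun; exact: continuous_cos.
exact: mulrl_measurable.
Qed.

(** Once [ff y] is written as an integral over p, the double integral is not absolutely convergent
    in x. The factor exp(-d|x|) makes Fubini applicable, and the product formula for cosines turns
    the x-integral into Poisson kernels of width d centred at q and -q. *)
Lemma has_int_damped y d q : 0 < y -> 0 < d ->
  has_int (fun x => cos (q * x) * expR (- (d * `|x|)) * ff y x)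
    (Rint (fun p => 2^-1 * (ff d (p - q) + ff d (p + q)) * expR (- (y * `|p|)))) /\
  integrableR (fun p => 2^-1 * (ff d (p - q) + ff d (p + q)) * expR (- (y * `|p|))).
Proof.
move=> y0 d0.
have [ie _] := has_int_expabs y0.
have [id _] := has_int_expabs d0.
have if_ : integrableR (fun x => cos (q * x) * expR (- (d * `|x|))).
  apply: le_integrableR id _.
    by apply: measurable_funM; [exact: measurable_cosl|exact: measurable_expabs].
  by move=> x; rewrite normrM (ger0_norm (expR_ge0 _)) ler_piMl ?expR_ge0// cos_max.
have mK : measurable_fun setT (fun z : R * R => cos (z.2 * z.1)).
  by have := measurable_cosM 0; under eq_fun do rewrite subr0.
have phiE p : Rint (fun x => cos (p * x) * (cos (q * x) * expR (- (d * `|x|)))) =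
    2^-1 * (ff d (p - q) + ff d (p + q)).
  have h := has_int_scale (2^-1) (has_int_add (has_int_cos_expabs (p - q) d0) (has_int_cos_expabs (p + q) d0)).
  case: h => _ <-; rewrite /Defs.Rint; apply: eq_Rintegral => x _.
  by rewrite (mulrBr x) (mulrDr x) cosB cosD !(mulrC x); field.
have [H1 H2] := has_int_fubini mK (fun z => cos_max _) ie if_ phiE.
split => //; apply: has_int_ext H1 => x /=.
case: (has_int_cos_expabs x y0) => _ ->; by rewrite mulrC.
Qed.

Lemma has_int_cos_ff y q : 0 < y ->
  has_int (fun x => cos (q * x) * ff y x) (2 * pi * expR (- (y * `|q|))).
Proof.
move=> y0; pose d n : R := n.+1%:R^-1.
have d0 n : 0 < d n by rewrite invr_gt0.
have d01 n : 0 < d n <= 1 by rewrite d0 invf_le1// ler1n.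
have cd : d n @[n --> \oo] --> (0 : R) by exact: cvg_harmonic.
pose I n := Rint (fun x => cos (q * x) * expR (- (d n * `|x|)) * ff y x).
have [ii I1] : integrableR (fun x => cos (q * x) * ff y x) /\
    I n @[n --> \oo] --> Rint (fun x => cos (q * x) * ff y x).
  apply: (@Rint_dominated _ _ (ff y)).
  - move=> n; apply: measurable_funM; last exact: measurable_ff.
    by apply: measurable_funM; [exact: measurable_cosl|exact: measurable_expabs].
  - by apply: measurable_funM; [exact: measurable_cosl|exact: measurable_ff].
  - move=> x; apply: cvgM; last exact: cvg_cst.
    rewrite -[X in _ --> X]mulr1; apply: cvgM; first exact: cvg_cst.
    rewrite -expR0; apply: (@cvg_comp _ _ _ (fun n => - (d n * `|x|)) expR _ (nbhs (0 : R))).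
      by rewrite -oppr0 -(mul0r `|x|); apply: cvgN; apply: cvgM => //; exact: cvg_cst.
    exact: continuous_expR.
  - by case: (has_int_ff y0).
  - move=> n x; rewrite normrM (ger0_norm (ff_ge0 _ y0)) ler_piMl ?ff_ge0//.
    rewrite normrM (ger0_norm (expR_ge0 _)) mulr_ile1 ?expR_ge0// ?cos_max//.
    by rewrite expR_le1 oppr_le0 mulr_ge0// ltW.
(* [D] vanishes at p = q and p = -q, the two points where the kernels of width d n concentrate. *)
pose D p := expR (- (y * `|p|)) - expR (- (y * `|q|)).
have D1 p : `|D p| <= 1.
  by rewrite (le_trans (expRN_dist _ _)) ?mulr_ge0 ?(ltW y0)// ge_min lexx.
have D2 p : `|D p| <= y * `| `|p| - `|q| |.
  rewrite (le_trans (expRN_dist _ _)) ?mulr_ge0 ?(ltW y0)// ge_min; apply/orP; right.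
  by rewrite -mulrBr normrM (gtr0_norm y0).
have Dm p : `|D p| <= y * `|p - q|.
  by rewrite (le_trans (D2 p))// ler_wpM2l ?(ltW y0)// ler_dist_dist.
have Dp p : `|D p| <= y * `|p + q|.
  rewrite (le_trans (D2 p))// ler_wpM2l ?(ltW y0)//.
  by have := ler_dist_dist p (- q); rewrite normrN opprK.
pose J n p := D p * ff (d n) (p - q) + D p * ff (d n) (p + q).
have mff n c : measurable_fun setT (fun p => ff (d n) (p + c)).
  by apply: (measurableT_comp (measurable_ff (d0 n))); apply: measurable_funD.
have mD : measurable_fun setT D.
  by apply: measurable_funB => //; exact: measurable_expabs.
have [_ J0] : integrableR (fun _ : R => 0 : R) /\ Rint (J n) @[n --> \oo] --> Rint (fun _ : R => 0 : R).
  apply: (@Rint_dominated _ _ (fun p => (y + 2) * (ff 1 (p - q) + ff 1 (p + q)))).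
  - by move=> n; apply: measurable_funD; apply: measurable_funM.
  - by [].
  - have cff (u : R) : u != 0 -> ff (d n) u @[n --> \oo] --> (0 : R).
      move=> u0.
      have h : 2 * d n * (u ^+ 2 + d n ^+ 2)^-1 @[n --> \oo] --> 2 * 0 * (u ^+ 2 + 0 ^+ 2)^-1.
        apply: cvgM; first by apply: cvgM => //; exact: cvg_cst.
        apply: cvgV; first by rewrite expr0n addr0 expf_neq0.
        by apply: cvgD; [exact: cvg_cst|rewrite !expr2; apply: cvgM].
      rewrite mulr0 mul0r in h; rewrite (_ : (fun n => ff (d n) u) = (fun n => 2 * d n / (u ^+ 2 + d n ^+ 2)))//.
      by apply/funext => n; rewrite ffE.
    (* At the centre of a kernel its value 2 / d n blows up; there the product is identically zero
       because [D] is. *)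
    have cDff p u : (u == 0 -> D p = 0) -> D p * ff (d n) u @[n --> \oo] --> (0 : R).
      case: (eqVneq u 0) => [->|u0 _]; first by move=> ->//; rewrite (_ : (fun n => _) = fun=> 0); [exact: cvg_cst|apply/funext => n; rewrite mul0r].
      by rewrite -(mulr0 (D p)); apply: cvgM; [exact: cvg_cst|exact: cff].
    move=> p; rewrite -[X in _ --> X]addr0; apply: cvgD; apply: cDff => /eqP h.
      by have := Dm p; rewrite h normr0 mulr0 normr_le0 => /eqP.
    by have := Dp p; rewrite h normr0 mulr0 normr_le0 => /eqP.
  - by case: (has_int_scale (y + 2) (has_int_ff_shifts q ltr01)).
  - move=> n p; rewrite (le_trans (ler_normD _ _))// mulrDr lerD//; exact: ff_near_diagonal.
rewrite (_ : Rint _ = 0) in J0; last by case: (has_int0 R).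
(* Replacing exp(-y|p|) by its value at q leaves the total mass 4 pi of the two kernels; the error
   made is [J n]. *)
have IE n : I n = 2 * pi * expR (- (y * `|q|)) + 2^-1 * Rint (J n).
  have [[_ H1] H2] := has_int_damped q y0 (d0 n).
  rewrite /I H1; set h := (X in Rint X).
  have hh : has_int h (Rint h) by [].
  have h2 := has_int_scale (2^-1 * expR (- (y * `|q|))) (has_int_ff_shifts q (d0 n)).
  have := has_int_scale 2 (has_int_sub hh h2).
  rewrite (_ : (fun x => _) = J n); last first.
    by apply/funext => p; rewrite /h /J /D; field.
  by case=> _ ->; field.
have I2 : I n @[n --> \oo] --> 2 * pi * expR (- (y * `|q|)) + 2^-1 * 0.
  rewrite (funext IE); apply: cvgD; first exact: cvg_cst.
  by apply: cvgM => //; exact: cvg_cst.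
rewrite mulr0 addr0 in I2.
by split => //; exact: (cvg_unique _ I1 I2).
Qed.

Lemma has_int_cos_shift_ff y q a : 0 < y ->
  has_int (fun x => cos (q * (x - a)) * ff y x) (2 * pi * (cos (q * a) * expR (- (y * `|q|)))).
Proof.
move=> y0; have Hc := has_int_cos_ff q y0.
have [If fv] := has_int_ff y0.
have mc : measurable_fun setT (fun x : R => sin (q * x)).
  apply: (measurableT_comp (f := sin)); last exact: mulrl_measurable.
  by apply: continuous_measurable_fun; exact: continuous_sin.
have is_ : integrableR (fun x => sin (q * x) * ff y x).
  apply: le_integrableR If _.
    by apply: measurable_funM => //; exact: measurable_ff.
  by move=> x; rewrite normrM (ger0_norm (ff_ge0 _ y0)) ler_piMl ?ff_ge0// sin_max.
have Hs : has_int (fun x => sin (q * x) * ff y x) 0.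
  split=> //; set S := Rint _.
  have hS : has_int (fun x => sin (q * x) * ff y x) S by [].
  (* Reflection is available for nonnegative functions, so it is applied to (1 + sin) times the
     kernel. This becomes (1 - sin) times the kernel, and 2 pi + S = 2 pi - S forces S = 0. *)
  have h1 := has_int_add (has_int_ff y0) hS.
  have g0 x : 0 <= ff y x + sin (q * x) * ff y x.
    by rewrite -[X in X + _]mul1r -mulrDl mulr_ge0 ?ff_ge0.
  have cg : continuous (fun x => ff y x + sin (q * x) * ff y x).
    move=> x; apply: cvgD; first exact: continuous_ff.
    apply: cvgM; last exact: continuous_ff.
    apply: (is_derive_continuous (f := fun x => sin (q * x)) (df := fun x => cos (q * x) * q)) => t.
    by derive_to; ring.
  have h2 : has_int (fun x => ff y x - sin (q * x) * ff y x) (2 * pi + S).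
    apply: has_int_ext (has_int_opp g0 cg h1) => x /=.
    by rewrite ffNr mulrN sinN mulNr.
  have [_ e1] := has_int_sub (has_int_ff y0) hS; have [_ e2] := h2.
  by move: e1; rewrite e2 => e1; lra.
have := has_int_add (has_int_scale (cos (q * a)) Hc) (has_int_scale (sin (q * a)) Hs).
rewrite (_ : _ + _ = 2 * pi * (cos (q * a) * expR (- (y * `|q|)))); last by ring.
by apply: has_int_ext => x; rewrite mulrBr cosB; ring.
Qed.

(** A Parseval identity: the shift by [a] becomes the factor cos(qa), the sine part dropping out by
    evenness of the Poisson kernel. *)
Lemma has_int_pairing_ff (gh : R -> R) y a : 0 < y -> integrableR gh ->
  has_int (fun x => Rint (fun q => cos (q * (x - a)) * gh q) * ff y x)
    (2 * pi * Rint (fun q => cos (q * a) * (gh q * expR (- (y * `|q|))))) /\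
  integrableR (fun q => cos (q * a) * (gh q * expR (- (y * `|q|)))).
Proof.
move=> y0 ghi; have [If fv] := has_int_ff y0.
have phiE q : Rint (fun x => cos (q * (x - a)) * ff y x) = 2 * pi * (cos (q * a) * expR (- (y * `|q|))).
  by case: (has_int_cos_shift_ff q a y0).
have [H1 H2] := has_int_fubini (measurable_cosM a) (fun z => cos_max _) ghi If phiE.
have pi0 : (pi : R) != 0 by rewrite gt_eqF ?pi_gt0.
have [H3 H4] : has_int (fun q => cos (q * a) * (gh q * expR (- (y * `|q|))))
    ((2 * pi)^-1 * Rint (fun q => 2 * pi * (cos (q * a) * expR (- (y * `|q|))) * gh q)).
  have := has_int_scale (2 * pi)^-1 (conj H2 erefl).
  by apply: has_int_ext => q; move: (pi : R) pi0 => P P0; field.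
split=> //; rewrite H4 mulrA divff ?mul1r// mulf_neq0//.
Qed.

End FourierPairing.

(** * Taylor bounds, up to a uniform estimate near the pole of the strip kernel *)

Section HyperbolicBounds.
Variable R : realType.
Implicit Types (x t b B : R).

Lemma rcosh_ge1 x : 1 <= rcosh x.
Proof.
rewrite /rcosh ler_pdivlMr// mul1r expRN; have := expR_gt0 x.
move: (expR x) => e e0; rewrite -subr_ge0.
have -> : e + e^-1 - 2 = (e - 1) ^+ 2 / e by field; rewrite gt_eqF.
by rewrite mulr_ge0 ?sqr_ge0// invr_ge0 ltW.
Qed.

Lemma rcoshN x : rcosh (- x) = rcosh x.
Proof. by rewrite /rcosh opprK addrC. Qed.

Lemma rsinhN x : rsinh (- x) = - rsinh x.
Proof. by rewrite /rsinh opprK; ring. Qed.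

Lemma rsinh0 : rsinh 0 = 0 :> R.
Proof. by rewrite /rsinh oppr0 subrr mul0r. Qed.

Lemma rcosh0 : rcosh 0 = 1 :> R.
Proof. by rewrite /rcosh oppr0 expR0; field. Qed.

Lemma is_derive_rsinh x : is_derive x (1 : R) (@rsinh R) (rcosh x).
Proof. by rewrite /rcosh /rsinh; derive_to; field. Qed.

Lemma rsinh_gt0 x : 0 < x -> 0 < rsinh x.
Proof. by move=> x0; rewrite /rsinh divr_gt0// subr_gt0 ltr_expR; lra. Qed.

Lemma rsinh_ge0 x : 0 <= x -> 0 <= rsinh x.
Proof. by rewrite le_eqVlt => /predU1P[<-|/rsinh_gt0/ltW//]; rewrite rsinh0. Qed.

Lemma ler_rcosh x B : 0 <= x <= B -> rcosh x <= rcosh B.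
Proof.
move=> /andP[x0 xB]; rewrite -subr_ge0 /rcosh !expRN.
have := expR_gt0 x; have : expR x <= expR B by rewrite ler_expR.
have : 1 <= expR x by rewrite -expR0 ler_expR.
move: (expR x) (expR B) => e f e1 ef e0.
have -> : (f + f^-1) / 2 - (e + e^-1) / 2 = (f - e) * (e * f - 1) / (2 * e * f).
  by field; rewrite !gt_eqF//; lra.
by rewrite divr_ge0// ?mulr_ge0//; nra.
Qed.

Lemma rsinh_convex t x : 0 <= t <= 1 -> 0 <= x -> rsinh (t * x) <= t * rsinh x.
Proof.
move=> /andP[t0 t1] x0; rewrite -subr_ge0.
notypeclasses refine (@derive_ge0_ge0 R (fun x => t * rsinh x - rsinh (t * x))
  (fun x => t * (rcosh x - rcosh (t * x))) x _ _ _ _ _); last by rewrite x0 /=.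
- move=> y; rewrite /rsinh /rcosh; derive_to; by field.
- by rewrite !mulr0 rsinh0 mulr0 subr0.
- move=> y /andP[y0 _]; rewrite mulr_ge0// subr_ge0 ler_rcosh// mulr_ge0//=.
  by rewrite ler_piMl.
Qed.

Lemma sin_le_id x : 0 <= x -> sin x <= x.
Proof.
move=> x0; rewrite -subr_ge0.
notypeclasses refine (@derive_ge0_ge0 R (fun x => x - sin x) (fun x => 1 - cos x) x _ _ _ _ _); last by rewrite x0 /=.
- by move=> y; derive_to; ring.
- by rewrite sin0 subr0.
- by move=> y _; rewrite subr_ge0 cos_le1.
Qed.

Lemma cos_ge_quad x : 0 <= x -> 1 - x ^+ 2 / 2 <= cos x.
Proof.
move=> x0; rewrite -subr_ge0.
notypeclasses refine (@derive_ge0_ge0 R (fun x => cos x - (1 - x ^+ 2 / 2)) (fun x => x - sin x) x _ _ _ _ _); last by rewrite x0 /=.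
- by move=> y; derive_to; field.
- by rewrite cos0 expr0n /=; lra.
- by move=> y /andP[y0 _]; rewrite subr_ge0 sin_le_id.
Qed.

Lemma sin_ge_cubic x : 0 <= x -> x - x ^+ 3 / 6 <= sin x.
Proof.
move=> x0; rewrite -subr_ge0.
notypeclasses refine (@derive_ge0_ge0 R (fun x => sin x - (x - x ^+ 3 / 6)) (fun x => cos x - (1 - x ^+ 2 / 2)) x _ _ _ _ _); last by rewrite x0 /=.
- by move=> y; derive_to; field.
- by rewrite sin0 expr0n /=; lra.
- by move=> y /andP[y0 _]; rewrite subr_ge0 cos_ge_quad.
Qed.

Lemma cos_le_quartic x : 0 <= x -> cos x <= 1 - x ^+ 2 / 2 + x ^+ 4 / 24.
Proof.
move=> x0; rewrite -subr_ge0.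
notypeclasses refine (@derive_ge0_ge0 R (fun x => 1 - x ^+ 2 / 2 + x ^+ 4 / 24 - cos x) (fun x => sin x - (x - x ^+ 3 / 6)) x _ _ _ _ _); last by rewrite x0 /=.
- by move=> y; derive_to; field.
- by rewrite cos0 !expr0n /=; lra.
- by move=> y /andP[y0 _]; rewrite subr_ge0 sin_ge_cubic.
Qed.

Lemma rsinh_ge_id x : 0 <= x -> x <= rsinh x.
Proof.
move=> x0; rewrite -subr_ge0.
notypeclasses refine (@derive_ge0_ge0 R (fun x => rsinh x - x) (fun x => rcosh x - 1) x _ _ _ _ _); last by rewrite x0 /=.
- by move=> y; rewrite /rsinh /rcosh; derive_to; field.
- by rewrite rsinh0 subr0.
- by move=> y _; rewrite subr_ge0 rcosh_ge1.
Qed.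

Lemma rcosh_ge_quad x : 1 + x ^+ 2 / 2 <= rcosh x.
Proof.
wlog x0 : x / 0 <= x.
  by move=> H; case: (leP 0 x) => [/H//|/ltW]; rewrite -oppr_ge0 => /H; rewrite rcoshN sqrrN.
rewrite -subr_ge0.
notypeclasses refine (@derive_ge0_ge0 R (fun x => rcosh x - (1 + x ^+ 2 / 2)) (fun x => rsinh x - x) x _ _ _ _ _); last by rewrite x0 /=.
- by move=> y; rewrite /rsinh /rcosh; derive_to; field.
- by rewrite rcosh0 expr0n /=; lra.
- by move=> y /andP[y0 _]; rewrite subr_ge0 rsinh_ge_id.
Qed.

Lemma rcosh_le_quartic x B : `|x| <= B -> rcosh x <= 1 + x ^+ 2 / 2 + rcosh B * x ^+ 4 / 24.
Proof.
wlog x0 : x / 0 <= x.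
  move=> H; case: (leP 0 x) => [/H//|/ltW]; rewrite -oppr_ge0 => /H.
  rewrite rcoshN normrN sqrrN (_ : (- x) ^+ 4 = x ^+ 4) //; ring.
rewrite ger0_norm// => xB; set C := rcosh B.
have h1 y : 0 <= y <= B -> 0 <= C * y - rsinh y.
  notypeclasses refine (@derive_ge0_ge0 R (fun y => C * y - rsinh y) (fun y => C - rcosh y) B _ _ _ y).
  - by move=> z; rewrite /rsinh /rcosh; derive_to; field.
  - by rewrite rsinh0; ring.
  - by move=> z zB; rewrite subr_ge0 ler_rcosh.
have h2 y : 0 <= y <= B -> 0 <= 1 + C * y ^+ 2 / 2 - rcosh y.
  notypeclasses refine (@derive_ge0_ge0 R (fun y => 1 + C * y ^+ 2 / 2 - rcosh y) (fun y => C * y - rsinh y) B _ _ _ y) => //.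
  - by move=> z; rewrite /rsinh /rcosh; derive_to; field.
  - by rewrite rcosh0 expr0n /=; lra.
have h3 y : 0 <= y <= B -> 0 <= y + C * y ^+ 3 / 6 - rsinh y.
  notypeclasses refine (@derive_ge0_ge0 R (fun y => y + C * y ^+ 3 / 6 - rsinh y) (fun y => 1 + C * y ^+ 2 / 2 - rcosh y) B _ _ _ y) => //.
  - by move=> z; rewrite /rsinh /rcosh; derive_to; field.
  - by rewrite rsinh0 expr0n /=; lra.
rewrite -subr_ge0.
notypeclasses refine (@derive_ge0_ge0 R (fun y => 1 + y ^+ 2 / 2 + C * y ^+ 4 / 24 - rcosh y) (fun y => y + C * y ^+ 3 / 6 - rsinh y) B _ _ _ _ _) => //.
- by move=> z; rewrite /rsinh /rcosh; derive_to; field.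
- by rewrite rcosh0 !expr0n /=; lra.
- by rewrite x0.
Qed.

(** Both quotients have the same singular part at b = t = 0, so their difference is O(t), uniformly
    for bounded b. Away from the pole (t > 1) each quotient is bounded by a constant; near it,
    numerator and denominator are compared by Taylor bounds. *)
Lemma cot_pole_bound B : exists2 K : R, 0 <= K & forall t b, 0 < t < pi -> `|b| <= B ->
  `|sin t / (rcosh b - cos t) - 2 * t / (b ^+ 2 + t ^+ 2)| <= K * t.
Proof.
pose C := rcosh B; have C1 : 1 <= C by exact: rcosh_ge1.
exists (2 * C + 10); first lra.
move=> t b /andP[t0 tpi] bB.
have hb := rcosh_ge_quad b.
have b20 : 0 <= b ^+ 2 by exact: sqr_ge0.
case: (leP t 1) => t1; last first.
  have c1 : cos t <= cos 1.
    by rewrite ltW// ltr_cos ?in_itv/= ?ler01 ?(ltW t0) ?(ltW tpi) ?(ltW (lt_trans t1 tpi)).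
  (* The quartic bound gives cos 1 <= 13/24, hence the lower bound 11/24 for the denominator. *)
  have := @cos_le_quartic 1 ler01; rewrite !expr1n => c1'.
  have S0 : 11 / 24 <= rcosh b - cos t by lra.
  have n1 : `|sin t / (rcosh b - cos t)| <= 3.
    rewrite normrM normfV (gtr0_norm (x := rcosh b - cos t)); last lra.
    rewrite ler_pdivrMr; last lra.
    by have := sin_max t; lra.
  have m0 : 0 < b ^+ 2 + t ^+ 2 by exact: sqrDsqr_gt0.
  have n2 : `|2 * t / (b ^+ 2 + t ^+ 2)| <= 2.
    rewrite ger0_norm; last by rewrite divr_ge0 ?(ltW m0)//; lra.
    rewrite ler_pdivrMr//; nra.
  apply: (le_trans (ler_normB _ _)); nra.
have s1 := sin_le_id (ltW t0); have s2 := sin_ge_cubic (ltW t0).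
have c1 := cos_ge_quad (ltW t0); have c2 := cos_le_quartic (ltW t0).
have hb2 := rcosh_le_quartic bB; rewrite -/C in hb2.
(* Here S = m + O(m^2) and sin t = t + O(t m), while S >= m/2; the difference of the quotients is
   then O(t m^2) / (S m) = O(t). *)
pose S := rcosh b - cos t; pose m := (b ^+ 2 + t ^+ 2) / 2.
have t20 : 0 < t ^+ 2 by rewrite exprn_gt0.
have t21 : t ^+ 2 <= 1 by nra.
have m0 : 0 < m by rewrite /m; lra.
have E4 z : z ^+ 4 = z ^+ 2 * z ^+ 2 :> R by rewrite -exprD.
have E3 : t ^+ 3 = t * t ^+ 2 by rewrite -exprS.
have tm : t ^+ 2 <= 2 * m by rewrite /m; lra.
have bm : b ^+ 2 <= 2 * m by rewrite /m; lra.
have Sm : m / 2 <= S by rewrite /S /m; rewrite !E4 in c2; nra.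
have S0 : 0 < S by lra.
have mS : `|m - S| <= C * m ^+ 2.
  rewrite ler_norml; apply/andP; split; rewrite /S.
    have : rcosh b - cos t - m <= C * b ^+ 4 / 24 by rewrite /m; lra.
    rewrite E4 => h.
    have : b ^+ 2 * b ^+ 2 <= 4 * m ^+ 2 by rewrite expr2; nra.
    nra.
  have : m - (rcosh b - cos t) <= t ^+ 4 / 24 by rewrite /m; lra.
  rewrite E4 => h.
  have : t ^+ 2 * t ^+ 2 <= 4 * m ^+ 2 by rewrite expr2; nra.
  nra.
have sm : `|sin t - t| <= t * m.
  rewrite ler_norml; apply/andP; split; last nra.
  rewrite E3 in s2; nra.
rewrite -/S (_ : b ^+ 2 + t ^+ 2 = 2 * m); last by rewrite /m; field.
clearbody S m.
have -> : sin t / S - 2 * t / (2 * m) = ((sin t - t) * m + t * (m - S)) / (S * m).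
  by field; rewrite !gt_eqF.
rewrite normrM normfV (gtr0_norm (mulr_gt0 S0 m0)) (ler_pdivrMr _ _ (mulr_gt0 S0 m0)).
apply: (@le_trans _ _ (t * m * m + t * (C * m ^+ 2))).
  apply: (le_trans (ler_normD _ _)); rewrite !normrM (gtr0_norm t0) (gtr0_norm m0).
  by rewrite lerD// ?ler_wpM2r ?ler_wpM2l// ltW.
have -> : t * m * m + t * (C * m ^+ 2) = t * m * m * (1 + C) by ring.
have -> : (2 * C + 10) * t * (S * m) = t * m * S * (2 * C + 10) by ring.
apply: (@le_trans _ _ (t * m * S * 2 * (1 + C))).
  rewrite ler_wpM2r//; first lra.
  by rewrite -!mulrA !(ler_wpM2l (ltW _))//; lra.
have : 0 <= t * m * S by rewrite !mulr_ge0// ltW.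
nra.
Qed.

End HyperbolicBounds.

(** * The strip kernel of width n and its transform *)

Section StripKernel.
Variable R : realType.
Implicit Types (n r x q u : R).

Lemma gammahat_strip n r q : 0 < n -> q != 0 ->
  gammahat (pi / n) r q = rsinh (`|q| * (n - r) / 2) / rsinh (`|q| * n / 2).
Proof.
move=> n0 q0; have p0 : (0 : R) < pi by exact: pi_gt0.
rewrite /gammahat mulf_eq0 invr_eq0 (gt_eqF p0) (gt_eqF n0) /= (negbTE q0).
have -> : q / 2 * (pi / (pi / n) - r) = q * (n - r) / 2.
  by move: (pi : R) p0 => P P0; field; rewrite !gt_eqF.
have -> : q * pi / (2 * (pi / n)) = q * n / 2.
  by move: (pi : R) p0 => P P0; field; rewrite !gt_eqF.
case: (ltP q 0) => [qn|/ger0_norm ->//]; rewrite ltr0_norm// !mulNr !rsinhN.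
by rewrite invrN mulrNN.
Qed.

Lemma gammahat_strip0 n r : 0 < n -> gammahat (pi / n) r 0 = (n - r) / n.
Proof.
move=> n0; have p0 : (0 : R) < pi by exact: pi_gt0.
rewrite /gammahat mulf_eq0 invr_eq0 (gt_eqF p0) (gt_eqF n0) /= eqxx.
by move: (pi : R) p0 => P P0; field; rewrite !gt_eqF.
Qed.

(** The difference equals exp(-n|q|/2) sinh(r|q|/2) / sinh(n|q|/2), and convexity of sinh bounds the
    quotient by r/n. The lower bound yields domination by exp(-r|q|/2); the upper one integrates to
    4r/n^2. *)
Lemma gammahat_strip_dist n r q : 0 < n -> 0 <= r <= n ->
  0 <= expR (- (r / 2 * `|q|)) - gammahat (pi / n) r q <= r / n * expR (- (n / 2 * `|q|)).
Proof.
move=> n0 /andP[r0 rn]; case: (eqVneq q 0) => [->|q0].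
  rewrite gammahat_strip0// normr0 !mulr0 oppr0 expR0 mulr1.
  have -> : 1 - (n - r) / n = r / n by field; rewrite gt_eqF.
  by rewrite lexx andbT divr_ge0// ltW.
rewrite gammahat_strip//.
have u0 : 0 < `|q| by rewrite normr_gt0.
move: (`|q|) u0 => u u0.
have v0 : 0 < u * n / 2 by rewrite divr_gt0// mulr_gt0.
have s0 := rsinh_gt0 v0.
have -> : expR (- (r / 2 * u)) - rsinh (u * (n - r) / 2) / rsinh (u * n / 2) =
    expR (- (n / 2 * u)) * rsinh (r / n * (u * n / 2)) / rsinh (u * n / 2).
  apply: (mulIf (lt0r_neq0 s0)); rewrite mulrBl !divfK ?gt_eqF//.
  have -> : u * (n - r) / 2 = u * n / 2 - u * r / 2 by field.
  have -> : r / n * (u * n / 2) = u * r / 2 by field; rewrite gt_eqF.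
  have -> : r / 2 * u = u * r / 2 by field.
  have -> : n / 2 * u = u * n / 2 by field.
  rewrite /rsinh opprB !expRB !expRN.
  by field; rewrite !gt_eqF ?expR_gt0.
have rn01 : 0 <= r / n <= 1 by rewrite divr_ge0 ?(ltW n0)//= ler_pdivrMr// mul1r.
have h := rsinh_convex rn01 (ltW v0).
apply/andP; split.
  rewrite divr_ge0 ?(ltW s0)// mulr_ge0 ?expR_ge0// rsinh_ge0// mulr_ge0 ?(ltW v0)//.
  by case/andP: rn01.
by rewrite ler_pdivrMr// [leLHS]mulrC [leRHS]mulrAC ler_wpM2r ?expR_ge0.
Qed.

Lemma gammahat_strip_ge0 n r q : 0 < n -> 0 <= r <= n -> 0 <= gammahat (pi / n) r q.
Proof.
move=> n0 /andP[r0 rn]; case: (eqVneq q 0) => [->|q0].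
  by rewrite gammahat_strip0// divr_ge0 ?subr_ge0 ?(ltW n0).
by rewrite gammahat_strip// divr_ge0// rsinh_ge0// divr_ge0// mulr_ge0 ?subr_ge0 ?(ltW n0).
Qed.

Lemma gammahat_strip_le n r q : 0 < n -> 0 <= r <= n ->
  gammahat (pi / n) r q <= expR (- (r / 2 * `|q|)).
Proof. by move=> n0 rn; have /andP[] := gammahat_strip_dist q n0 rn; rewrite subr_ge0. Qed.

Lemma measurable_rsinh (c : R -> R) : measurable_fun setT c -> measurable_fun setT (fun q => rsinh (c q)).
Proof.
move=> mc; apply: (measurableT_comp (f := @rsinh R)) => //.
apply: continuous_measurable_fun.
by apply: (is_derive_continuous (df := @rcosh R)) => y; exact: is_derive_rsinh.
Qed.

Lemma measurable_gammahat (hb r : R) : measurable_fun setT (gammahat hb r).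
Proof.
case: (eqVneq hb 0) => [->|hb0].
  rewrite (_ : gammahat 0 r = (fun p => expR (- (r / 2 * `|p|)))).
    exact: measurable_expabs.
  by apply/funext => p; rewrite /gammahat eqxx; congr expR; field.
rewrite (_ : gammahat hb r = fun p => if p == 0 then (pi / hb - r) / (pi / hb)
  else rsinh (p / 2 * (pi / hb - r)) / rsinh (p * pi / (2 * hb))); last first.
  by apply/funext => p; rewrite /gammahat (negbTE hb0).
apply: measurable_fun_ifT.
- by apply: measurable_fun_eqr => //; exact: measurable_cst.
- exact: measurable_cst.
- apply: measurable_funM.
    by apply: measurable_rsinh; do 2 apply: measurable_funM => //.
  apply: (measurableT_comp (@measurable_invr R)).
  by apply: measurable_rsinh; do 2 apply: measurable_funM => //.
Qed.

Lemma measurable_cosr x : measurable_fun setT (fun q : R => cos (q * x)).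
Proof. by under eq_fun do rewrite mulrC; exact: measurable_cosl. Qed.

Lemma integrable_cosM x (g : R -> R) : integrableR g -> integrableR (fun q => cos (q * x) * g q).
Proof.
move=> gi; apply: (@le_integrableR _ _ (fun q => `|g q|)).
- by apply: measurable_funM; [exact: measurable_cosr|exact: integrableR_measurable].
- exact: integrable_norm.
- by move=> q; rewrite normrM ler_piMl// cos_max.
Qed.

Lemma integrable_gammahat_strip n r : 0 < n -> 0 < r <= n -> integrableR (gammahat (pi / n) r).
Proof.
move=> n0 /andP[r0 rn]; have r20 : 0 < r / 2 by lra.
apply: le_integrableR (proj1 (has_int_expabs r20)) _; first exact: measurable_gammahat.
move=> q; rewrite ger0_norm ?gammahat_strip_ge0 ?(ltW r0)//.
by rewrite gammahat_strip_le ?(ltW r0).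
Qed.

Let Phi n r x := Rint (fun q => cos (q * x) * gammahat (pi / n) r q).

Let has_int_Phi n r x : 0 < n -> 0 < r <= n ->
  has_int (fun q => cos (q * x) * gammahat (pi / n) r q) (Phi n r x).
Proof. by move=> n0 rn; split=> //; exact/integrable_cosM/integrable_gammahat_strip. Qed.

Let Phi_dist n r x : 0 < n -> 0 < r <= n -> `|ff (r / 2) x - Phi n r x| <= 4 * r / n ^+ 2.
Proof.
move=> n0 rn; have /andP[r0 rn'] := rn.
have r20 : 0 < r / 2 by lra.
have n20 : 0 < n / 2 by lra.
have h1 := has_int_sub (has_int_cos_expabs x r20) (has_int_Phi x n0 rn).
have h2 := has_int_scale (r / n) (has_int_expabs n20).
apply: le_trans (has_int_norm h1 h2 _) _; last first.
  by rewrite le_eqVlt; apply/orP; left; apply/eqP; field; rewrite gt_eqF.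
move=> q; rewrite -mulrBr normrM; have rn2 : 0 <= r <= n by rewrite (ltW r0).
have /andP[d0 d1] := gammahat_strip_dist q n0 rn2.
by rewrite (ger0_norm d0) (le_trans _ d1)// ler_piMl// cos_max.
Qed.

(** Multiply numerator and denominator of the transform by 2 cosh(n|q|/2): the numerator becomes
    sinh((2n-r)|q|/2) - sinh(r|q|/2), the denominator sinh(n|q|). *)
Let Phi_double n r x : 0 < n -> 0 < r < n ->
  Phi n r x = Phi (2 * n) r x - Phi (2 * n) (2 * n - r) x.
Proof.
move=> n0 /andP[r0 rn].
have n20 : 0 < 2 * n by lra.
have h1 : has_int (fun q => cos (q * x) * gammahat (pi / (2 * n)) r q) (Phi (2 * n) r x).
  by apply: has_int_Phi => //; lra.
have h2 : has_int (fun q => cos (q * x) * gammahat (pi / (2 * n)) (2 * n - r) q) (Phi (2 * n) (2 * n - r) x).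
  by apply: has_int_Phi => //; lra.
have [_ <-] := has_int_sub h1 h2; rewrite /Phi; congr Defs.Rint; apply/funext => q.
rewrite -mulrBr; congr (_ * _); case: (eqVneq q 0) => [->|q0].
  by rewrite !gammahat_strip0//; field; rewrite gt_eqF.
rewrite !gammahat_strip//.
have u0 : 0 < `|q| by rewrite normr_gt0.
move: (`|q|) u0 => u u0.
have -> : u * (2 * n) / 2 = u * n / 2 + u * n / 2 by field.
have -> : u * (2 * n - r) / 2 = u * n / 2 + (u * n / 2 - u * r / 2) by field.
have -> : u * (2 * n - (2 * n - r)) / 2 = u * r / 2 by field.
have -> : u * (n - r) / 2 = u * n / 2 - u * r / 2 by field.
rewrite /rsinh !opprD !opprK !expRD !expRN.
have : 1 < expR (u * n / 2) by rewrite -expR0 ltr_expR divr_gt0// mulr_gt0.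
have := expR_gt0 (u * r / 2).
move: (expR (u * n / 2)) (expR (u * r / 2)) => e f f0 e1.
have e0 : e != 0 by rewrite gt_eqF//; lra.
have f0' : f != 0 by rewrite gt_eqF.
have h : e ^+ 2 - 1 != 0 by rewrite gt_eqF//; nra.
have h' : e ^+ 2 + 1 != 0 by rewrite gt_eqF//; nra.
have h'' : e ^+ 2 * e ^+ 2 - 1 != 0 by rewrite gt_eqF//; nra.
field; rewrite f0' e0 /=.
by rewrite ?h ?h' ?h''.
Qed.

(** With the half angles t and b, cosh 2b - cos 2t = 2 (cosh b - cos t)(cosh b + cos t), and the
    claim is the partial fraction decomposition; the second factor belongs to pi - t, that is, to 2n
    - r. *)
Let gammaf_double n r x : 0 < n -> 0 < r < n ->
  gammaf (pi / n) r x = gammaf (pi / (2 * n)) r x - gammaf (pi / (2 * n)) (2 * n - r) x.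
Proof.
move=> n0 /andP[r0 rn]; have p0 : (0 : R) < pi by exact: pi_gt0.
rewrite /gammaf !mulf_eq0 !invr_eq0 !mulf_eq0 !gt_eqF//=.
pose t : R := pi * r / (2 * n); pose b : R := pi * x / n.
have -> : pi / n * r = t *+ 2.
  by rewrite /t mulr2n; move: (pi : R) => P; field; rewrite gt_eqF.
have -> : pi / (2 * n) * r = t by rewrite /t mulrAC.
have -> : pi / (2 * n) * (2 * n - r) = - t + pi.
  by rewrite /t; move: (pi : R) => P; field; rewrite gt_eqF.
have -> : 2 * (pi / n) * x = b + b.
  by rewrite /b; move: (pi : R) => P; field; rewrite gt_eqF.
have -> : 2 * (pi / (2 * n)) * x = b.
  by rewrite /b; move: (pi : R) => P; field; rewrite gt_eqF.
rewrite sinDpi cosDpi sinN cosN opprK sin_mulr2n cos_mulr2n.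
have t0 : 0 < t by rewrite /t divr_gt0 ?mulr_gt0//; lra.
have tp : t < pi.
  by rewrite /t -mulrA gtr_pMr// ltr_pdivrMr; lra.
have s0 : 0 < sin t by apply: sin_gt0_pi; rewrite t0.
have cs := cos2Dsin2 t.
have c1 : cos t < 1 by nra.
have c2 : -1 < cos t by nra.
have B1 := rcosh_ge1 b.
have -> : rcosh (b + b) = 2 * rcosh b ^+ 2 - 1.
  rewrite /rcosh opprD !expRD !expRN; have := expR_gt0 b.
  by move: (expR b) => e e0; field; rewrite gt_eqF.
move: (rcosh b) B1 (cos t) (sin t) c1 c2 {cs s0} => c c0 k s k1 k2.
move: (pi : R) => P.
have h : c - k != 0 by rewrite gt_eqF//; lra.
have h' : c - - k != 0 by rewrite gt_eqF//; lra.
have h2 : 2 * c ^+ 2 - 1 - (k ^+ 2 *+ 2 - 1) != 0.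
  have -> : 2 * c ^+ 2 - 1 - (k ^+ 2 *+ 2 - 1) = 2 * ((c - k) * (c - - k)) by rewrite mulr2n; ring.
  by rewrite !mulf_neq0.
rewrite !mulr2n in h2 *.
by field; rewrite ?h ?h' ?h2 ?(gt_eqF n0).
Qed.

(** This is [cot_pole_bound] rescaled by t = pi r/n, b = 2 pi x/n. Requiring n0 <= n confines b to a
    fixed interval, so [K] depends on x and n0 but not on n and r. *)
Let gammaf_dist n0 x : 0 < n0 -> exists2 K : R, 0 <= K & forall n r, n0 <= n -> 0 < r < n ->
  `|gammaf (pi / n) r x - ff (r / 2) x| <= K * r / n ^+ 2.
Proof.
move=> n00; have p0 : (0 : R) < pi by exact: pi_gt0.
have [K K0 HK] := cot_pole_bound (2 * pi * `|x| / n0).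
exists (2 * pi * K * pi); first by rewrite !mulr_ge0 ?(ltW p0).
move=> n r n0n /andP[r0 rn]; have n_0 : 0 < n by lra.
rewrite ffE; last lra.
rewrite /gammaf mulf_eq0 invr_eq0 !gt_eqF//=.
pose t : R := pi / n * r; pose b : R := 2 * (pi / n) * x.
have t0 : 0 < t < pi.
  rewrite /t !mulr_gt0 ?invr_gt0//= -mulrA gtr_pMr// mulrC ltr_pdivrMr//; lra.
have bB : `|b| <= 2 * pi * `|x| / n0.
  rewrite /b !normrM normfV (gtr0_norm p0) (gtr0_norm n_0) ger0_norm//.
  rewrite -!mulrA ler_wpM2l// ler_wpM2l ?(ltW p0)// mulrC ler_wpM2l// lef_pV2 ?posrE//.
have := HK _ _ t0 bB => h.
have -> : 2 * (r / 2) / (x ^+ 2 + (r / 2) ^+ 2) = 2 * (pi / n) * (2 * t / (b ^+ 2 + t ^+ 2)).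
  have a1 : 0 < x ^+ 2 + (r / 2) ^+ 2 by apply: sqrDsqr_gt0; lra.
  have a2 : 0 < b ^+ 2 + t ^+ 2 by apply: sqrDsqr_gt0; case/andP: t0.
  have -> : b ^+ 2 + t ^+ 2 = 4 * (pi / n) ^+ 2 * (x ^+ 2 + (r / 2) ^+ 2).
    by rewrite /b /t; move: (pi : R) => P; field; rewrite gt_eqF.
  rewrite /t; move: a1; set m := x ^+ 2 + _ => a1; clearbody m.
  by move: (pi : R) p0 => P P0; field; rewrite !gt_eqF.
rewrite -/t -/b -mulrA -mulrBr normrM ger0_norm; last by rewrite mulr_ge0// divr_ge0// ltW.
apply: (@le_trans _ _ (2 * (pi / n) * (K * t))).
  by rewrite ler_wpM2l// mulr_ge0// divr_ge0// ltW.
rewrite /t le_eqVlt; apply/orP; left; apply/eqP.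
by move: (pi : R) => P; field; rewrite gt_eqF.
Qed.

(* Herglotz's trick: the difference of the two sides of [gammaf = Phi] obeys the
   same doubling relation, is O(r / n^2), and must therefore vanish. *)
Let herglotz (d : R -> R -> R) n0 K : 0 < n0 -> 0 <= K ->
  (forall n r, n0 <= n -> 0 < r < n -> `|d n r| <= K * r / n ^+ 2) ->
  (forall n r, n0 <= n -> 0 < r < n -> d n r = d (2 * n) r - d (2 * n) (2 * n - r)) ->
  forall r, 0 < r < n0 -> d n0 r = 0.
Proof.
move=> n00 K0 dK d2.
(* The weight n turns doubling into averaging: n |d n r| is at most the mean of the values of 2n |d
   (2n) .| at r and 2n - r. The decay bound with r < n keeps all these values below [K]. *)
pose E := [set v | exists n r, [/\ n0 <= n, 0 < r < n & v = n * `|d n r|]].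
have EK : ubound E K.
  move=> v [n [r [n0n rn ->]]]; have n_0 : 0 < n by lra.
  have := dK n r n0n rn; case/andP: rn => r0 rn.
  rewrite ler_pdivlMr ?exprn_gt0// => h.
  rewrite -(@ler_pM2r _ n)//; apply: (@le_trans _ _ (K * r)); last by rewrite ler_wpM2l// ltW.
  by move: h; rewrite expr2; nra.
have E0 : E !=set0.
  by exists (n0 * `|d n0 (n0 / 2)|), n0, (n0 / 2); split=> //; lra.
have supE : has_sup E by split=> //; exists K.
pose M := sup E.
have EM n r : n0 <= n -> 0 < r < n -> n * `|d n r| <= M.
  by move=> n0n rn; apply: sup_upper_bound => //; exists n, r.
(* Only the branch with r fixed is followed; at each doubling the mirrored argument is bounded by
   the supremum [M]. On that branch r stays below the initial n, so the weighted value is at most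
   2^-k K, which gives M <= 2^-k K next. *)
have step k n r : n0 <= n -> 0 < r < n ->
    n * `|d n r| <= 2^-1 ^+ k * (2 ^+ k * n * `|d (2 ^+ k * n) r|) + (1 - 2^-1 ^+ k) * M.
  elim: k n r => [|k IH] n r n0n rn; first by rewrite !expr0 !mul1r subrr mul0r addr0.
  have /andP[r0 rn'] := rn.
  have n2 : n0 <= 2 * n by lra.
  have r2 : 0 < r < 2 * n by lra.
  have r3 : 0 < 2 * n - r < 2 * n by lra.
  have h1 := IH (2 * n) r n2 r2.
  have h2 := EM (2 * n) (2 * n - r) n2 r3.
  have h3 : n * `|d n r| <= 2^-1 * (2 * n * `|d (2 * n) r|) + 2^-1 * (2 * n * `|d (2 * n) (2 * n - r)|).
    rewrite d2// [leRHS](_ : _ = n * (`|d (2 * n) r| + `|d (2 * n) (2 * n - r)|)); last by field.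
    by rewrite ler_wpM2l ?ler_normB//; lra.
  have e1 : 2 ^+ k.+1 * n = 2 ^+ k * (2 * n) by rewrite exprSr mulrA.
  rewrite e1 exprS; lra.
have MK k : M <= 2^-1 ^+ k * K.
  have p2 : 0 < (2^-1 : R) ^+ k by rewrite exprn_gt0// invr_gt0.
  have q2 : (1 : R) <= 2 ^+ k by rewrite exprn_ege1// ler1n.
  suff : M <= 2^-1 ^+ k * (2^-1 ^+ k * K) + (1 - 2^-1 ^+ k) * M.
    by move=> h; rewrite -(ler_pM2l p2); lra.
  apply: ge_sup => // v [n [r [n0n rn ->]]]; apply: le_trans (step k n r n0n rn) _.
  rewrite lerD2r ler_wpM2l ?(ltW p2)//.
  have /andP[r0 rn'] := rn.
  have n_0 : 0 < n by lra.
  have N0 : n <= 2 ^+ k * n by rewrite ler_peMl// ltW.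
  have := dK (2 ^+ k * n) r (le_trans n0n N0).
  have -> : 0 < r < 2 ^+ k * n by rewrite r0 (lt_le_trans rn' N0).
  move=> /(_ isT); set N := 2 ^+ k * n; have N_0 : 0 < N by rewrite (lt_le_trans n_0 N0).
  rewrite ler_pdivlMr ?exprn_gt0// => h.
  have -> : 2^-1 ^+ k * K = K * n / N.
    rewrite /N exprVn; have : 0 < (2 : R) ^+ k by rewrite exprn_gt0.
    by move: (2 ^+ k) => A A0; field; rewrite !gt_eqF.
  rewrite ler_pdivlMr//; apply: le_trans (_ : K * r <= _); last by rewrite ler_wpM2l// ltW.
  by move: h; rewrite expr2; lra.
have M0 : M <= 0.
  rewrite leNgt; apply/negP => M0.
  have KM0 : 0 <= K / M by rewrite divr_ge0// ltW.
  have := MK (Num.bound (K / M)); have := archi_boundP KM0.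
  move: (Num.bound _) => k; rewrite ltr_pdivrMr// => h1.
  rewrite exprVn mulrC ler_pdivlMr ?exprn_gt0// => h2.
  have : M * k%:R <= M * 2 ^+ k by rewrite ler_pM2l// -natrX ler_nat ltnW// ltn_expl.
  lra.
move=> r rn; have := EM n0 r (lexx _) rn => h.
have : n0 * `|d n0 r| <= 0 by lra.
by rewrite pmulr_rle0// normr_le0 => /eqP.
Qed.

Lemma has_int_gammaf n r x : 0 < n -> 0 < r < n ->
  has_int (fun q => cos (q * x) * gammahat (pi / n) r q) (gammaf (pi / n) r x).
Proof.
move=> n0 rn; have rn' : 0 < r <= n by case/andP: rn => -> /ltW.
have [K K0 HK] := gammaf_dist x n0.
have K4 : 0 <= K + 4 by lra.
suff : gammaf (pi / n) r x - Phi n r x = 0.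
  by move/eqP; rewrite subr_eq0 => /eqP ->; exact: has_int_Phi.
apply: (herglotz (d := fun n r => gammaf (pi / n) r x - Phi n r x) n0 K4) => // m s nm sm.
  have m0 : 0 < m by lra.
  have -> : gammaf (pi / m) s x - Phi m s x =
    (gammaf (pi / m) s x - ff (s / 2) x) + (ff (s / 2) x - Phi m s x) by ring.
  have -> : (K + 4) * s / m ^+ 2 = K * s / m ^+ 2 + 4 * s / m ^+ 2 by rewrite !mulrDl.
  apply: le_trans (ler_normD _ _) _; apply: lerD; first exact: HK.
  by apply: Phi_dist => //; case/andP: sm => -> /ltW.
have m0 : 0 < m by lra.
have H (a b c e : R) : (a - b) - (c - e) = (a - c) - (b - e) by ring.
exact: etrans (congr2 (fun u v => u - v) (gammaf_double x m0 sm) (Phi_double x m0 sm)) (H _ _ _ _).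
Qed.

End StripKernel.

(** * The transform of Psi, its interpolation and its recurrence *)

Section PsiTransform.
Variable R : realType.
Implicit Types (x z a q u : R) (k p : nat).

(** [ff] is odd in its index and zero at index 0; the sign accounts for both. *)
Definition ffhat z q : R := Num.sg z * expR (- (`|z| * `|q|)).

Definition Psihat k p q : R := \sum_(i < k) ffhat (((p + 1 + 2 * i)%:R - k%:R) / 2) q.

Lemma has_int_uniq (f : R -> R) (u v : R) : has_int f u -> has_int f v -> u = v.
Proof. by move=> [_ <-] [_ <-]. Qed.

Lemma ffN z x : ff (- z) x = - ff z x.
Proof. by rewrite /ff oppr_eq0; case: ifP => _; rewrite ?oppr0// sqrrN mulrN mulNr. Qed.

Lemma ffhatN z q : ffhat (- z) q = - ffhat z q.
Proof. by rewrite /ffhat sgrN normrN mulNr. Qed.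

Lemma has_int_ffhat z x : has_int (fun q => cos (q * x) * ffhat z q) (ff z x).
Proof.
wlog z0 : z / 0 <= z.
  move=> H; case: (leP 0 z) => [/H//|/ltW]; rewrite -oppr_ge0 => /H /(has_int_scale (-1)).
  rewrite ffN mulN1r opprK; apply: has_int_ext => q.
  by rewrite ffhatN mulN1r mulrN opprK.
move: z0; rewrite le_eqVlt => /predU1P[<-|z0].
  rewrite /ff eqxx; apply: has_int_ext (has_int0 R) => q.
  by rewrite /ffhat sgr0 mul0r mulr0.
apply: has_int_ext (has_int_cos_expabs x z0) => q.
by rewrite /ffhat (gtr0_sg z0) (gtr0_norm z0) mul1r.
Qed.

Lemma has_int_Psihat k p x : has_int (fun q => cos (q * x) * Psihat k p q) (Psi k p x).
Proof.
rewrite /Psi; apply: has_int_ext (has_int_sum _ (fun i _ => has_int_ffhat _ x)) => q.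
by rewrite /Psihat mulr_sumr.
Qed.

Lemma has_int_pairing_ffz (gh : R -> R) z a : integrableR gh ->
  has_int (fun x => Rint (fun q => cos (q * (x - a)) * gh q) * ff z x)
    (2 * pi * Rint (fun q => cos (q * a) * (gh q * ffhat z q))) /\
  integrableR (fun q => cos (q * a) * (gh q * ffhat z q)).
Proof.
move=> ghi; wlog z0 : z / 0 <= z.
  move=> H; case: (leP 0 z) => [/H//|/ltW]; rewrite -oppr_ge0 => /H [h1 h2].
  have [i2 e2] := has_int_scale (-1) (conj h2 erefl).
  have E : (fun q => -1 * (cos (q * a) * (gh q * ffhat (- z) q))) =
      (fun q => cos (q * a) * (gh q * ffhat z q)).
    by apply/funext => q; rewrite ffhatN; ring.
  rewrite E in i2 e2; split=> //; rewrite e2 mulrCA.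
  by apply: has_int_ext (has_int_scale (-1) h1) => x; rewrite ffN; ring.
move: z0; rewrite le_eqVlt => /predU1P[<-|z0].
  have E : (fun q => cos (q * a) * (gh q * ffhat 0 q)) = fun=> 0.
    by apply/funext => q; rewrite /ffhat sgr0 mul0r !mulr0.
  rewrite E; have [i0 e0] := has_int0 R; split=> //; rewrite e0 mulr0.
  by apply: has_int_ext (has_int0 R) => x; rewrite /ff eqxx mulr0.
have [h1 h2] := has_int_pairing_ff a z0 ghi.
have E : (fun q => cos (q * a) * (gh q * ffhat z q)) =
    (fun q => cos (q * a) * (gh q * expR (- (z * `|q|)))).
  by apply/funext => q; rewrite /ffhat (gtr0_sg z0) (gtr0_norm z0) mul1r.
by rewrite E.
Qed.

Lemma has_int_pairing_Psi (g gh : R -> R) k p a : integrableR gh ->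
  (forall x, g x = Rint (fun q => cos (q * x) * gh q)) ->
  has_int (fun x => g (x - a) * Psi k p x)
    (2 * pi * Rint (fun q => cos (q * a) * (gh q * Psihat k p q))) /\
  integrableR (fun q => cos (q * a) * (gh q * Psihat k p q)).
Proof.
move=> ghi gE.
have h (i : 'I_k) := has_int_pairing_ffz (((p + 1 + 2 * i)%:R - k%:R) / 2) a ghi.
have hs := has_int_sum (index_enum _) (fun i (_ : predT i) => conj (h i).2 erefl).
have [i1 e1] : has_int (fun q => cos (q * a) * (gh q * Psihat k p q))
   (\sum_(i < k) Rint (fun q => cos (q * a) * (gh q * ffhat (((p + 1 + 2 * i)%:R - k%:R) / 2) q))).
  by apply: has_int_ext hs => q; rewrite /Psihat !mulr_sumr.
split=> //; rewrite e1 mulr_sumr.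
apply: has_int_ext (has_int_sum (index_enum _) (fun i (_ : predT i) => (h i).1)) => x.
by rewrite /Psi mulr_sumr; apply: eq_bigr => i _; rewrite gE.
Qed.

(** The factor 2 sinh(|q|/2) makes the sum telescope: each term is a difference of exponentials
    whose exponents differ by one step. Only the first exponent |p - k| and the last p + k
    survive. *)
Lemma PsihatE k p q : 2 * rsinh (`|q| / 2) * Psihat k p q =
  expR (- (`|p%:R - k%:R| / 2 * `|q|)) - expR (- ((p + k)%:R / 2 * `|q|)).
Proof.
pose f i : R := - expR (- (`|p%:R - k%:R + 2 * i%:R| / 2 * `|q|)).
transitivity (\sum_(0 <= i < k) (f i.+1 - f i)); last first.
  rewrite telescope_sumr// /f mulr0 addr0 opprK addrC; congr (_ - _).
  rewrite (_ : p%:R - k%:R + 2 * k%:R = (p + k)%:R); last by rewrite natrD; ring.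
  by rewrite ger0_norm.
rewrite /Psihat mulr_sumr big_mkord; apply: eq_bigr => i _.
rewrite /f /ffhat opprK; move: (`|q|) => u.
rewrite (natrD _ (p + 1)) (natrD _ p) natrM -(natr1 i).
set P := p%:R; set Kk := k%:R; set I := (i : nat)%:R.
(* The quantity w is an integer, so these cases fix the sign of w + 1 and both absolute values. At w
   = -1 the term is the convention f_0 = 0, consistent with |w| = |w + 2|. *)
have : [\/ P - Kk + 2 * I >= 0, P - Kk + 2 * I <= -2 | P - Kk + 2 * I = -1] .
  rewrite /P /Kk /I -natrM addrAC -natrD.
  case: (leqP k (p + 2 * i)) => h1.
    by constructor 1; rewrite subr_ge0 ler_nat.
  case: (leqP (p + 2 * i + 2) k) => h2.
    by constructor 2; move: h2; rewrite -(ler_nat R) natrD; lra.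
  have -> : k%:R = (p + 2 * i).+1%:R :> R by congr _%:R; lia.
  by constructor 3; rewrite -natr1; ring.
rewrite /rsinh; set w := P - Kk + 2 * I.
have -> : (P + 1 + 2 * I - Kk) / 2 = (w + 1) / 2 by rewrite /w; congr (_ / _); ring.
have -> : P - Kk + 2 * (I + 1) = w + 2 by rewrite /w; ring.
have E (x y : R) : expR x = expR y * expR (x - y) by rewrite -expRD; congr expR; ring.
case=> hw.
- rewrite gtr0_sg ?ger0_norm; try lra.
  rewrite (E (- (w / 2 * u)) (- ((w + 1) / 2 * u))).
  rewrite (E (- ((w + 2) / 2 * u)) (- ((w + 1) / 2 * u))).
  have -> : - (w / 2 * u) - - ((w + 1) / 2 * u) = u / 2 by field.
  have -> : - ((w + 2) / 2 * u) - - ((w + 1) / 2 * u) = - (u / 2) by field.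
  by field.
- rewrite ltr0_sg ?ler0_norm; try lra.
  rewrite (E (- (- w / 2 * u)) (- (- ((w + 1) / 2) * u))).
  rewrite (E (- (- (w + 2) / 2 * u)) (- (- ((w + 1) / 2) * u))).
  have -> : - (- w / 2 * u) - - (- ((w + 1) / 2) * u) = - (u / 2) by field.
  have -> : - (- (w + 2) / 2 * u) - - (- ((w + 1) / 2) * u) = u / 2 by field.
  by field.
- rewrite hw (_ : (-1 + 1) / 2 = 0); last by field.
  rewrite sgr0 mul0r mulr0 (_ : -1 + 2 = 1); last by ring.
  by rewrite normrN normr1; ring.
Qed.

(* Off the source [k = p], [Psihat] is a combination of exp(k|q|/2) and
   exp(-k|q|/2), which the transform of the strip kernel interpolates. *)
Lemma Psihat_strip (a b k p : nat) q : q != 0 -> (a <= k <= b)%N -> (a < b)%N ->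
  (p <= a)%N || (b <= p)%N ->
  gammahat (pi / (b%:R - a%:R)) (k%:R - a%:R) q * Psihat a p q +
  gammahat (pi / (b%:R - a%:R)) (b%:R - k%:R) q * Psihat b p q = Psihat k p q.
Proof.
move=> q0 /andP[ak kb] ab pab.
have n0 : 0 < b%:R - a%:R :> R by rewrite subr_gt0 ltr_nat.
rewrite !gammahat_strip//.
have u0 : 0 < `|q| by rewrite normr_gt0.
have s0 : 0 < rsinh (`|q| / 2) by apply: rsinh_gt0; lra.
have sn0 : 0 < rsinh (`|q| * (b%:R - a%:R) / 2) by apply: rsinh_gt0; rewrite divr_gt0// mulr_gt0.
apply: (mulfI (lt0r_neq0 sn0)); apply: (mulfI (lt0r_neq0 (mulr_gt0 (ltr0Sn R 1) s0))).
have -> : b%:R - a%:R - (k%:R - a%:R) = b%:R - k%:R :> R by ring.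
have -> : b%:R - a%:R - (b%:R - k%:R) = k%:R - a%:R :> R by ring.
rewrite [RHS]mulrCA PsihatE.
transitivity (rsinh (`|q| * (b%:R - k%:R) / 2) * (2 * rsinh (`|q| / 2) * Psihat a p q)
   + rsinh (`|q| * (k%:R - a%:R) / 2) * (2 * rsinh (`|q| / 2) * Psihat b p q)).
  by move: sn0; set X := rsinh (_ * (b%:R - a%:R) / 2) => X0; field; rewrite gt_eqF.
rewrite !PsihatE; move: (`|q|) => u.
have Eb (m m' : nat) : rsinh (u * (m%:R - m'%:R) / 2) =
   (expR (m%:R * u / 2) / expR (m'%:R * u / 2) - expR (m'%:R * u / 2) / expR (m%:R * u / 2)) / 2.
  by rewrite /rsinh -!expRB; congr ((expR _ - expR _) / _); field.
rewrite !Eb.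
have Ep (m m' : nat) : expR (- ((m + m')%:R / 2 * u)) = (expR (m%:R * u / 2) * expR (m'%:R * u / 2))^-1.
  by rewrite -expRD -expRN natrD; congr expR; field.
rewrite !Ep.
case/orP: pab => hp.
  have Em (m : nat) : (a <= m)%N -> expR (- (`|p%:R - m%:R| / 2 * u)) = expR (p%:R * u / 2) / expR (m%:R * u / 2).
    move=> am; rewrite distrC ger0_norm ?subr_ge0 ?ler_nat ?(leq_trans hp)//.
    by rewrite -expRB; congr expR; field.
  rewrite !Em// ?(ltnW ab)//.
  by field; rewrite !gt_eqF ?expR_gt0.
have Em (m : nat) : (m <= b)%N -> expR (- (`|p%:R - m%:R| / 2 * u)) = expR (m%:R * u / 2) / expR (p%:R * u / 2).
  move=> mb; rewrite ger0_norm ?subr_ge0 ?ler_nat ?(leq_trans mb)//.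
  by rewrite -expRB; congr expR; field.
rewrite !Em// ?(ltnW ab)//.
by field; rewrite !gt_eqF ?expR_gt0.
Qed.

(** For k >= p, [PsihatE] is exp(-k|q|/2) times a factor independent of k: only the decaying
    solution is present, so a single end determines it. *)
Lemma Psihat_halfplane (a k p : nat) q : q != 0 -> (p <= a <= k)%N ->
  gammahat 0 (k%:R - a%:R) q * Psihat a p q = Psihat k p q.
Proof.
move=> q0 /andP[pa ak]; rewrite /gammahat eqxx.
have u0 : 0 < `|q| by rewrite normr_gt0.
have s0 : 0 < rsinh (`|q| / 2) by apply: rsinh_gt0; lra.
apply: (mulfI (lt0r_neq0 (mulr_gt0 (ltr0Sn R 1) s0))).
rewrite mulrCA !PsihatE; move: (`|q|) => u.
rewrite !(distrC p%:R) !ger0_norm ?subr_ge0 ?ler_nat ?(leq_trans pa)//.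
by rewrite mulrBr -!expRD !natrD; congr (expR _ - expR _); field.
Qed.

(** In [PsihatE] both exponentials solve the homogeneous recurrence, except at the kink of |p - k|
    at k = p. The defect there, exp(-|q|/2) - exp(|q|/2), is minus the prefactor. *)
Lemma Psihat_laplacian (k p : nat) q : q != 0 -> (0 < k)%N ->
  Psihat k.+1 p q + Psihat k.-1 p q - 2 * rcosh (q / 2) * Psihat k p q = - (k == p)%:R.
Proof.
move=> q0; case: k => // k _ /=.
have u0 : 0 < `|q| by rewrite normr_gt0.
have -> : rcosh (q / 2) = rcosh (`|q| / 2).
  by case: (leP 0 q) => h; [rewrite ger0_norm|rewrite ltr0_norm// mulNr rcoshN].
have s0 : 0 < rsinh (`|q| / 2) by apply: rsinh_gt0; lra.
apply: (mulfI (lt0r_neq0 (mulr_gt0 (ltr0Sn R 1) s0))).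
rewrite mulrBr mulrDr (mulrCA _ (2 * rcosh _)) !PsihatE; move: (`|q|) => u.
have Ep (m m' : nat) : expR (- ((m + m')%:R / 2 * u)) = (expR (m%:R * u / 2) * expR (m'%:R * u / 2))^-1.
  by rewrite -expRD -expRN natrD; congr expR; field.
have ES (m : nat) : expR (m.+1%:R * u / 2) = expR (m%:R * u / 2) * expR (u / 2).
  by rewrite -expRD -natr1; congr expR; field.
have Em1 (m : nat) : (p <= m)%N -> expR (- (`|p%:R - m%:R| / 2 * u)) = expR (p%:R * u / 2) / expR (m%:R * u / 2).
  move=> am; rewrite distrC ger0_norm ?subr_ge0 ?ler_nat//.
  by rewrite -expRB; congr expR; field.
have Em2 (m : nat) : (m <= p)%N -> expR (- (`|p%:R - m%:R| / 2 * u)) = expR (m%:R * u / 2) / expR (p%:R * u / 2).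
  move=> am; rewrite ger0_norm ?subr_ge0 ?ler_nat//.
  by rewrite -expRB; congr expR; field.
rewrite /rcosh /rsinh expRN !Ep.
case: (ltngtP k.+1 p) => h.
- rewrite (Em2 k.+2) ?(Em2 k.+1) ?(Em2 k); try lia.
  by rewrite !ES /= mulr0n oppr0 mulr0; field; rewrite !gt_eqF ?expR_gt0.
- rewrite (Em1 k.+2) ?(Em1 k.+1) ?(Em1 k); try lia.
  by rewrite !ES /= mulr0n oppr0 mulr0; field; rewrite !gt_eqF ?expR_gt0.
- rewrite (Em1 k.+2) ?(Em1 k.+1) ?(Em2 k); try lia.
  by rewrite -h !ES /= mulr1n; field; rewrite !gt_eqF ?expR_gt0.
Qed.

(** This is the strip kernel with n = 2 and r = 1, where sinh(|q|/2) / sinh(|q|) = 1 / (2 cosh(q/2))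
    and the cosine in the denominator of [gammaf] vanishes. *)
Lemma has_int_sech x : has_int (fun q => cos (q * x) * (2 * rcosh (q / 2))^-1) (pi / rcosh (pi * x)).
Proof.
have r12 : 0 < (1 : R) < 2 by rewrite ltr01 ltr1n.
have := has_int_gammaf x (ltr0Sn R 1) r12.
have -> : gammaf (pi / 2) 1 x = pi / rcosh (pi * x).
  rewrite /gammaf mulf_eq0 invr_eq0 !gt_eqF ?pi_gt0//= mulr1 sin_pihalf cos_pihalf subr0 mulr1.
  by rewrite (mulrC 2) divfK.
apply: has_int_off0 => q q0; congr (_ * _); rewrite gammahat_strip//.
have u0 : 0 < `|q| by rewrite normr_gt0.
have -> : rcosh (q / 2) = rcosh (`|q| / 2).
  by case: (leP 0 q) => h; [rewrite ger0_norm|rewrite ltr0_norm// mulNr rcoshN].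
move: (`|q|) u0 => u u0.
have -> : u * 2 / 2 = u / 2 + u / 2 by field.
have -> : u * (2 - 1) / 2 = u / 2 by field.
rewrite /rsinh /rcosh opprD !expRD expRN.
have : 1 < expR (u / 2) by rewrite expR_gt1; lra.
move: (expR (u / 2)) => e e1.
have h1 : e != 0 by rewrite gt_eqF//; lra.
have h2 : e ^+ 2 - 1 != 0 by rewrite gt_eqF//; nra.
have h3 : e ^+ 2 + 1 != 0 by rewrite gt_eqF//; nra.
have h4 : e ^+ 2 * e ^+ 2 - 1 != 0 by rewrite gt_eqF//; nra.
by field; rewrite ?h1 ?h2 ?h3 ?h4.
Qed.

End PsiTransform.

(** * Energy of one string, of one hole, and of the whole state *)

Section ExcitationEnergy.
Variables (R : realType) (L : nat) (sb D : nat -> nat) (lth : nat -> nat -> R).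
Variables (nu : seq nat) (lam : nat -> nat -> R) (j0 : nat).
Hypothesis sb_gt0 : forall j, (1 <= j <= L)%N -> (0 < sb j)%N.
Hypothesis sb_lt : forall j, (1 <= j < L)%N -> (sb j < sb j.+1)%N.
Hypothesis j0L : (1 <= j0 <= L)%N.

Let s := s2 sb.
Let hb := hbar R L sb.
Let p := sb j0.
Let U k q : R := Psihat k p q.
Let C (h : R -> R) (a : R) : R := Rint (fun q => cos (q * a) * h q).

Lemma s2_lt i : (i < L)%N -> (s i < s i.+1)%N.
Proof.
rewrite /s /s2 /=; case: i => [|i] iL /=; first exact: sb_gt0.
exact: sb_lt.
Qed.

Lemma s2_le i j : (i <= j <= L)%N -> (s i <= s j)%N.
Proof.
move=> /andP[ij jL]; elim: j ij jL => [|j IH]; first by rewrite leqn0 => /eqP ->.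
rewrite leq_eqVlt => /predU1P[->//|]; rewrite ltnS => ij jL.
by rewrite (leq_trans (IH ij (ltnW jL)))// ltnW// s2_lt.
Qed.

Lemma s2_eq_sea i : (1 <= i <= L)%N -> (s i == p) = (i == j0).
Proof.
move=> iL; apply/eqP/eqP => [|->]; last by rewrite /s /s2 /p; case: (j0) j0L.
have -> : p = s j0 by rewrite /s /s2 /p; case: (j0) j0L.
case: (ltngtP i j0) => // h e.
  have := s2_lt (i := i); have := @s2_le i.+1 j0; lia.
have := s2_lt (i := j0); have := @s2_le j0.+1 i; lia.
Qed.

(** The spin s of the energy is itself a sea spin, which supplies the side condition of
    [Psihat_strip]. *)
Lemma source_outside i : (i < L)%N -> (p <= s i)%N || (s i.+1 <= p)%N.
Proof.
move=> iL; have -> : p = s j0 by rewrite /s /s2 /p; case: (j0) j0L.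
case: (leqP j0 i) => h; first by rewrite s2_le// h ltnW.
by rewrite orbC s2_le// h; lia.
Qed.

Lemma source_below_top : (p <= s L)%N.
Proof.
have -> : p = s j0 by rewrite /s /s2 /p; case: (j0) j0L.
by apply: s2_le; lia.
Qed.

Lemma gap_ge1 i : (i < L)%N -> 1 <= (s i.+1)%:R - (s i)%:R :> R.
Proof. by move=> /s2_lt; rewrite -(ler_nat R) -natr1; lra. Qed.

Lemma gammahat_hbar i (r q : R) : 0 <= r -> ((i < L)%N -> r <= (s i.+1)%:R - (s i)%:R) ->
  0 <= gammahat (hb i) r q <= 1.
Proof.
rewrite /hb /hbar => r0; case: ifP => iL rn.
  have n0 : 0 < (s i.+1)%:R - (s i)%:R :> R by have := gap_ge1 iL; lra.
  have rn' : 0 <= r <= (s i.+1)%:R - (s i)%:R by rewrite r0 rn.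
  rewrite gammahat_strip_ge0//= (le_trans (gammahat_strip_le q n0 rn'))//.
  by rewrite expR_le1 oppr_le0 mulr_ge0// divr_ge0.
by rewrite /gammahat eqxx expR_ge0/= expR_le1 mulNr oppr_le0 divr_ge0// mulr_ge0.
Qed.

(** The ends r = 0 and r = gap occur when two neighbouring sea spins differ by 1/2. As [gammahat] is
    constantly 1 at r = 0, decay has to come from the factor 1 / (2 cosh(q/2)). *)
Lemma integrable_kappahat_hbar i (r : R) :
  0 <= r -> ((i < L)%N -> r <= (s i.+1)%:R - (s i)%:R) -> integrableR (kappahat (hb i) r).
Proof.
move=> r0 rn; have [Is _] := has_int_sech (0 : R).
have E : (fun q : R => cos (q * 0) * (2 * rcosh (q / 2))^-1) = fun q => (2 * rcosh (q / 2))^-1.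
  by apply/funext => q; rewrite mulr0 cos0 mul1r.
rewrite E in Is; have mc := integrableR_measurable Is; apply: le_integrableR Is _.
  apply: measurable_funM; first exact: measurable_gammahat.
  exact: mc.
move=> q; rewrite /kappahat normrM.
have /andP[g0 g1] := gammahat_hbar q r0 rn.
have c0 : 0 <= (2 * rcosh (q / 2))^-1 by rewrite invr_ge0; have := rcosh_ge1 (q / 2); lra.
by rewrite (ger0_norm g0) (ger0_norm c0) ler_piMl.
Qed.

Lemma has_int_gammaf_hbar i (r x : R) : 0 < r -> ((i < L)%N -> r < (s i.+1)%:R - (s i)%:R) ->
  has_int (fun q => cos (q * x) * gammahat (hb i) r q) (gammaf (hb i) r x).
Proof.
rewrite /hb /hbar => r0; case: ifP => iL rn.
  by apply: has_int_gammaf; [have := gap_ge1 iL; lra|rewrite r0 rn].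
have r20 : 0 < r / 2 by lra.
have := has_int_cos_expabs x r20.
have -> : ff (r / 2) x = gammaf 0 r x.
  rewrite ffE// /gammaf eqxx; have := sqrDsqr_gt0 (2 * x) r0.
  by rewrite exprMn -natrX => h; field; rewrite gt_eqF.
apply: has_int_ext => q; rewrite /gammahat eqxx; congr (_ * expR _).
by rewrite mulNr mulrAC.
Qed.

Lemma integrable_gammahat_hbar i (r : R) : 0 < r -> ((i < L)%N -> r < (s i.+1)%:R - (s i)%:R) ->
  integrableR (gammahat (hb i) r).
Proof.
move=> r0 rn; have [I _] := has_int_gammaf_hbar 0 r0 rn.
rewrite (_ : (fun q => _) = gammahat (hb i) r) in I => //.
by apply/funext => q; rewrite mulr0 cos0 mul1r.
Qed.

Lemma pairing_kappa i r k a : 0 <= r -> ((i < L)%N -> r <= (s i.+1)%:R - (s i)%:R) ->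
  has_int (fun x => kappa (hb i) r (x - a) * Psi k p x)
    (2 * pi * C (fun q => kappahat (hb i) r q * U k q) a) /\
  integrableR (fun q => cos (q * a) * (kappahat (hb i) r q * U k q)).
Proof.
by move=> r0 rn; apply: has_int_pairing_Psi => //; exact: integrable_kappahat_hbar.
Qed.

Lemma pairing_gamma i r k a : 0 < r -> ((i < L)%N -> r < (s i.+1)%:R - (s i)%:R) ->
  has_int (fun x => gammaf (hb i) r (x - a) * Psi k p x)
    (2 * pi * C (fun q => gammahat (hb i) r q * U k q) a) /\
  integrableR (fun q => cos (q * a) * (gammahat (hb i) r q * U k q)).
Proof.
move=> r0 rn; apply: has_int_pairing_Psi; first exact: integrable_gammahat_hbar.
by move=> x; case: (has_int_gammaf_hbar x r0 rn).
Qed.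

Lemma Psihat_interpolation i k q : (i <= L)%N -> (s i <= k)%N -> ((i < L)%N -> (k <= s i.+1)%N) ->
  q != 0 ->
  gammahat (hb i) (k%:R - (s i)%:R) q * U (s i) q +
  (if (i < L)%N then gammahat (hb i) ((s i.+1)%:R - k%:R) q * U (s i.+1) q else 0) = U k q.
Proof.
move=> iL ik ki q0; rewrite /hb /hbar; case: ifP => [il|/negbT].
  by apply: Psihat_strip => //; [rewrite ik ki|exact: s2_lt|exact: source_outside].
rewrite -leqNgt => Li; have {Li iL} E : i = L by lia.
by rewrite addr0 Psihat_halfplane// ik andbT E source_below_top.
Qed.

(** The response of the adjacent seas reproduces the bare energy of the string; it enters [cfun]
    with a minus sign, so the net contribution to [DeltaE] is zero. *)
Lemma string_energy i k a : (i <= L)%N -> inRj L sb i k ->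
  C (fun q => gammahat (hb i) (k%:R - (s i)%:R) q * U (s i) q) a +
  (if (i < L)%N then C (fun q => gammahat (hb i) ((s i.+1)%:R - k%:R) q * U (s i.+1) q) a else 0)
  = Psi k p a.
Proof.
move=> iL /andP[ik]; rewrite -/s => ki.
have ki' : (i < L)%N -> (k < s i.+1)%N by move=> il; move: ki; rewrite leqNgt il.
have r1 : 0 < k%:R - (s i)%:R :> R by rewrite subr_gt0 ltr_nat.
have r1n : (i < L)%N -> k%:R - (s i)%:R < (s i.+1)%:R - (s i)%:R :> R.
  by move=> /ki'; rewrite ltrD2r ltr_nat.
have [_ h1] := pairing_gamma (s i) a r1 r1n.
apply: has_int_uniq (has_int_Psihat k p a).
have H q : q != 0 -> _ := @Psihat_interpolation i k q iL (ltnW ik) (fun h => ltnW (ki' h)).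
case: (boolP (i < L)%N) => il; last first.
  rewrite addr0; have := conj h1 erefl : has_int _ (C _ a).
  by apply: has_int_off0 => q /H; rewrite (negbTE il) addr0 => e; congr (_ * _).
have r2 : 0 < (s i.+1)%:R - k%:R :> R by rewrite subr_gt0 ltr_nat ki'.
have r2n : (i < L)%N -> (s i.+1)%:R - k%:R < (s i.+1)%:R - (s i)%:R :> R.
  by move=> _; rewrite ltrD2l ltrN2 ltr_nat.
have [_ h2] := pairing_gamma (s i.+1) a r2 r2n.
apply: has_int_off0 (has_int_add (conj h1 erefl) (conj h2 erefl)) => q /H.
by rewrite il -mulrDr => e; congr (_ * _).
Qed.

Lemma hole_energy i a : (1 <= i <= L)%N ->
  (if (i < L)%N then C (fun q => kappahat (hb i) ((s i.+1)%:R - (s i)%:R - 1) q * U (s i.+1) q) a else 0)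
  + C (fun q => kappahat (hb i.-1) ((s i)%:R - (s i.-1)%:R - 1) q * U (s i.-1) q) a
  + (C (fun q => kappahat (hb i) 1 q * U (s i) q) a + C (fun q => kappahat (hb i.-1) 1 q * U (s i) q) a)
  - Psi (s i) p a = - (if i == j0 then pi / rcosh (pi * a) else 0).
Proof.
move=> /andP[i1 iL].
have iE : i.-1.+1 = i by lia.
have i1L : (i.-1 < L)%N by lia.
have gap1 := gap_ge1 i1L; rewrite iE in gap1.
have sl := s2_lt i1L; rewrite iE in sl.
have [_ hB] := @pairing_kappa i.-1 ((s i)%:R - (s i.-1)%:R - 1) (s i.-1) a
  ltac:(lra) ltac:(by rewrite iE; lra).
have [_ hC] := @pairing_kappa i 1 (s i) a ler01 (@gap_ge1 i).
have [_ hC'] := @pairing_kappa i.-1 1 (s i) a ler01 (@gap_ge1 i.-1).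
pose A q : R := if (i < L)%N then kappahat (hb i) ((s i.+1)%:R - (s i)%:R - 1) q * U (s i.+1) q else 0.
have hA : has_int (fun q => cos (q * a) * A q)
  (if (i < L)%N then C (fun q => kappahat (hb i) ((s i.+1)%:R - (s i)%:R - 1) q * U (s i.+1) q) a else 0).
  rewrite /A; case: ifP => il; last first.
    by apply: has_int_ext (has_int0 R) => q; rewrite mulr0.
  have g := gap_ge1 il.
  have [_ h] := @pairing_kappa i ((s i.+1)%:R - (s i)%:R - 1) (s i.+1) a ltac:(lra) ltac:(lra).
  by split.
have hT := has_int_sub (has_int_add (has_int_add hA (conj hB erefl))
  (has_int_add (conj hC erefl) (conj hC' erefl))) (has_int_Psihat (s i) p a).
apply: has_int_uniq hT _.
have hS : has_int (fun q => - (i == j0)%:R * (cos (q * a) * (2 * rcosh (q / 2))^-1))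
    (- (if i == j0 then pi / rcosh (pi * a) else 0)).
  have := has_int_scale (- (i == j0)%:R) (has_int_sech a).
  by case: ifP => _; rewrite ?mulN1r ?oppr0 ?mul0r.
apply: has_int_off0 hS => q q0; apply/esym.
have c0 : 2 * rcosh (q / 2) != 0 by rewrite gt_eqF//; have := rcosh_ge1 (q / 2); lra.
(* The neighbours of [s i] are interpolated on the intervals above and below; with a gap of 1 they
   are the far end points, which the weak inequalities allow. *)
have I1 := @Psihat_interpolation i (s i).+1 q iL (leqnSn _) (@s2_lt i) q0.
have sm : (s i.-1 <= (s i).-1)%N by lia.
have sm' : (i.-1 < L)%N -> ((s i).-1 <= s i.-1.+1)%N by rewrite iE leq_pred.
have I2 := @Psihat_interpolation i.-1 (s i).-1 q (ltnW i1L) sm sm' q0.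
rewrite i1L iE in I2.
have si0 : (0 < s i)%N by lia.
have lap := Psihat_laplacian p q0 si0; rewrite s2_eq_sea ?i1// in lap.
have e1 : (s i).+1%:R - (s i)%:R = 1 :> R by rewrite -natr1; ring.
have e2 : (s i)%:R - (s i).-1%:R = 1 :> R by rewrite -[in X in X - _](prednK si0) -natr1; ring.
have e3 : (s i.+1)%:R - (s i).+1%:R = (s i.+1)%:R - (s i)%:R - 1 :> R by rewrite -natr1; ring.
have e4 : (s i).-1%:R - (s i.-1)%:R = (s i)%:R - (s i.-1)%:R - 1 :> R by rewrite -[in RHS](prednK si0) -natr1; ring.
rewrite e1 e3 in I1; rewrite e2 e4 in I2.
rewrite -/(U _ _) -/(U (s i).-1 q) -/(U (s i) q) -I1 -I2 in lap.
have -> : - (i == j0)%:R * (cos (q * a) * (2 * rcosh (q / 2))^-1) =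
   cos (q * a) * (- (i == j0)%:R / (2 * rcosh (q / 2))) by ring.
have H1 (c g1 g2 g3 g4 u1 u2 u3 w : R) : w != 0 ->
    c * (g1 / w * u1) + c * (g2 / w * u2) + (c * (g3 / w * u3) + c * (g4 / w * u3)) - c * u3 =
    c * ((g3 * u3 + g1 * u1 + (g2 * u2 + g4 * u3) - w * u3) / w) by move=> w0; field.
have H2 (c g2 g3 g4 u2 u3 w : R) : w != 0 ->
    c * 0 + c * (g2 / w * u2) + (c * (g3 / w * u3) + c * (g4 / w * u3)) - c * u3 =
    c * ((g3 * u3 + 0 + (g2 * u2 + g4 * u3) - w * u3) / w) by move=> w0; field.
by rewrite -lap /A /kappahat /U; case: ifP => _; [exact: H1|exact: H2].
Qed.

Let string i (f : nat -> R -> R) : R :=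
  \sum_(k < size nu | inRj L sb i k) \sum_(l < nuk nu k) f k (lam k l).

(** These five are seen from sea j: [below], [above] and [self] tell where the excitation at [a]
    sits relative to it. *)
Let hole_below j a := C (fun q => kappahat (hb j.-1) ((s j)%:R - (s j.-1)%:R - 1) q * U (s j) q) a.
Let hole_above j a := C (fun q => kappahat (hb j) ((s j.+1)%:R - (s j)%:R - 1) q * U (s j) q) a.
Let hole_self j a := C (fun q => kappahat (hb j) 1 q * U (s j) q) a
  + C (fun q => kappahat (hb j.-1) 1 q * U (s j) q) a.
Let string_below j k a := C (fun q => gammahat (hb j.-1) ((s j)%:R - k%:R) q * U (s j) q) a.
Let string_above j k a := C (fun q => gammahat (hb j) (k%:R - (s j)%:R) q * U (s j) q) a.

Lemma pairing_rcE j : (1 <= j <= L)%N ->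
  pairing_rc L sb D lth nu lam j (Psi (s j) p) =
  \sum_(d < Dz L D j.-1) hole_below j (lth j.-1 d) + \sum_(d < Dz L D j.+1) hole_above j (lth j.+1 d)
  + \sum_(d < Dz L D j) hole_self j (lth j d)
  - string j.-1 (string_below j) - string j (string_above j)
  - \sum_(d < Dz L D j) Psi (s j) p (lth j d).
Proof.
move=> /andP[j1 jL]; rewrite /pairing_rc; congr (_ - _).
have jE : j.-1.+1 = j by lia.
have j1L : (j.-1 < L)%N by lia.
have pi0 : (pi : R) != 0 by rewrite gt_eqF ?pi_gt0.
have hA : has_int (fun x => (\sum_(d < Dz L D j.-1)
     kappa (hb j.-1) ((s j)%:R - (s j.-1)%:R - 1) (x - lth j.-1 d)) * Psi (s j) p x)
   (2 * pi * \sum_(d < Dz L D j.-1) hole_below j (lth j.-1 d)).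
  rewrite mulr_sumr; under eq_fun do rewrite mulr_suml; apply: has_int_sum => d _.
  have g := gap_ge1 j1L; rewrite jE in g.
  by case: (@pairing_kappa j.-1 ((s j)%:R - (s j.-1)%:R - 1) (s j) (lth j.-1 d)) => //; rewrite ?jE; lra.
have hB : has_int (fun x => (\sum_(d < Dz L D j.+1)
     kappa (hb j) ((s j.+1)%:R - (s j)%:R - 1) (x - lth j.+1 d)) * Psi (s j) p x)
   (2 * pi * \sum_(d < Dz L D j.+1) hole_above j (lth j.+1 d)).
  rewrite mulr_sumr; under eq_fun do rewrite mulr_suml; apply: has_int_sum => d _.
  (* An index d exists only if [Dz] is nonzero at j.+1, that is, if there is a sea above j. *)
  have jl : (j < L)%N by case: d; rewrite /Dz /=; case: (ltnP L j.+1) => // h d; lia.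
  have g := gap_ge1 jl.
  by case: (@pairing_kappa j ((s j.+1)%:R - (s j)%:R - 1) (s j) (lth j.+1 d)) => //; lra.
have hC : has_int (fun x => (\sum_(d < Dz L D j)
     (kappa (hb j) 1 (x - lth j d) + kappa (hb j.-1) 1 (x - lth j d))) * Psi (s j) p x)
   (2 * pi * \sum_(d < Dz L D j) hole_self j (lth j d)).
  rewrite mulr_sumr; under eq_fun do rewrite mulr_suml; apply: has_int_sum => d _.
  rewrite mulrDr; under eq_fun do rewrite mulrDl; apply: has_int_add.
    by case: (@pairing_kappa j 1 (s j) (lth j d) ler01 (@gap_ge1 j)).
  by case: (@pairing_kappa j.-1 1 (s j) (lth j d) ler01 (@gap_ge1 j.-1)).
have hS : has_int (fun x => (\sum_(k < size nu | inRj L sb j.-1 k) \sum_(l < nuk nu k)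
     gammaf (hb j.-1) ((s j)%:R - k%:R) (x - lam k l)) * Psi (s j) p x)
   (2 * pi * string j.-1 (string_below j)).
  rewrite mulr_sumr; under eq_fun do rewrite mulr_suml.
  apply: has_int_sum => k /andP[k1]; rewrite leqNgt j1L /= jE -/s => k2.
  rewrite mulr_sumr; under eq_fun do rewrite mulr_suml; apply: has_int_sum => l _.
  case: (@pairing_gamma j.-1 ((s j)%:R - k%:R) (s j) (lam k l)) => //.
    by rewrite subr_gt0 ltr_nat.
  by move=> _; rewrite jE ltrD2l ltrN2 ltr_nat.
have hS' : has_int (fun x => (\sum_(k < size nu | inRj L sb j k) \sum_(l < nuk nu k)
     gammaf (hb j) (k%:R - (s j)%:R) (x - lam k l)) * Psi (s j) p x)
   (2 * pi * string j (string_above j)).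
  rewrite mulr_sumr; under eq_fun do rewrite mulr_suml.
  apply: has_int_sum => k /andP[k1 k2].
  rewrite mulr_sumr; under eq_fun do rewrite mulr_suml; apply: has_int_sum => l _.
  case: (@pairing_gamma j (k%:R - (s j)%:R) (s j) (lam k l)) => //.
    by rewrite subr_gt0 ltr_nat.
  by move=> jl; move: k2; rewrite leqNgt jl /= ltrD2r ltr_nat.
have h := has_int_sub (has_int_sub
  (has_int_scale (2 * pi)^-1 (has_int_add (has_int_add hA hB) hC))
  (has_int_scale (2 * pi)^-1 hS)) (has_int_scale (2 * pi)^-1 hS').
have V (P a b c e f : R) : P != 0 ->
  (2 * P)^-1 * (2 * P * a + 2 * P * b + 2 * P * c) - (2 * P)^-1 * (2 * P * e)
    - (2 * P)^-1 * (2 * P * f) = a + b + c - e - f by move=> P0; field.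
rewrite (V _ _ _ _ _ _ pi0) in h.
have W (P a b c e f y : R) :
  P * (a * y + b * y + c * y) - P * (e * y) - P * (f * y) =
  (P * (a + b + c) + (- P * e - P * f)) * y by ring.
by apply: (proj2 (has_int_ext _ h)) => x; exact: W.
Qed.

(** Sea 0 is fictitious, its Psi being an empty sum; it can be added to the sums over seas so that
    the lowest interval also has two ends. *)
Lemma psihat_sea0 (h : R -> R) a : C (fun q => h q * U (s 0) q) a = 0.
Proof.
have [_ e] := has_int0 R; rewrite -[RHS]e; congr Defs.Rint.
by apply/funext => q; rewrite /U /s /s2 /Psihat big_ord0 !mulr0.
Qed.

Lemma DeltaE_sea : DeltaE L sb D lth nu lam p = \sum_(d < D j0) pi / rcosh (pi * lth j0 d).
Proof.
have Z (a a' b b' c e e' f f' g t h : R) : a = a' -> b = b' -> f = f' -> e = e' ->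
  a' + b' + c - g = - h -> f' + e' = t -> - (a + b + c - e - f - g) - t = h.
  by move=> -> -> -> ->; lra.
rewrite /DeltaE.
under [X in - X - _]eq_big_nat => j jL do rewrite pairing_rcE//.
rewrite !sumrB !big_split /=.
(* A hole in sea i acts on sea i + 1. The shift drops i = 0, which has no holes, and adds i = L with
   value zero. *)
have EA : \sum_(1 <= j < L.+1) \sum_(d < Dz L D j.-1) hole_below j (lth j.-1 d) =
    \sum_(1 <= i < L.+1) \sum_(d < Dz L D i) (if (i < L)%N then hole_below i.+1 (lth i d) else 0).
  rewrite big_add1 /=.
  case: (posnP L) => [->|L0]; first by rewrite !big_geq.
  rewrite big_ltn// [X in X + _ = _]big1 ?add0r; last by case.
  rewrite [RHS]big_nat_recr//= [X in _ = _ + X]big1 ?addr0; last by rewrite ltnn.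
  by apply: eq_big_nat => i /andP[_ iL]; apply: eq_bigr => d _; rewrite iL.
(* A hole in sea i acts on sea i - 1. The added term j = 0 vanishes with [U] at sea 0, and j = L has
   no holes above it. *)
have EB : \sum_(1 <= j < L.+1) \sum_(d < Dz L D j.+1) hole_above j (lth j.+1 d) =
    \sum_(1 <= i < L.+1) \sum_(d < Dz L D i) hole_above i.-1 (lth i d).
  transitivity (\sum_(0 <= j < L.+1) \sum_(d < Dz L D j.+1) hole_above j (lth j.+1 d)).
    by rewrite [RHS]big_ltn// [X in _ = X + _]big1 ?add0r// => d _; exact: psihat_sea0.
  rewrite big_nat_recr//= [X in _ + X]big1 ?addr0; last first.
    by case=> d; rewrite /Dz ltnS leqnn orbT.
  by rewrite [RHS]big_add1.
have ES : \sum_(1 <= j < L.+1) string j (string_above j) = \sum_(0 <= j < L.+1) string j (string_above j).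
  rewrite [RHS]big_ltn// [X in _ = X + _]big1 ?add0r// => k _.
  by rewrite big1// => l _; exact: psihat_sea0.
have ES' : \sum_(1 <= j < L.+1) string j.-1 (string_below j) =
    \sum_(0 <= i < L.+1) (if (i < L)%N then string i (string_below i.+1) else 0).
  rewrite big_add1 /= [RHS]big_nat_recr//= ltnn addr0.
  by apply: eq_big_nat => i /andP[_ ->].
have SE : \sum_(0 <= j < L.+1) string j (string_above j) +
    \sum_(0 <= i < L.+1) (if (i < L)%N then string i (string_below i.+1) else 0) =
    \sum_(j < L.+1) string j (fun k a => Psi k p a).
  rewrite -big_split /= big_mkord; apply: eq_bigr => i _.
  have iL : (i <= L)%N by rewrite -ltnS.
  have -> : (if (i < L)%N then string i (string_below i.+1) else 0) =
      string i (fun k a => if (i < L)%N then string_below i.+1 k a else 0).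
    by case: ifP => // _; rewrite /string big1// => k _; rewrite big1.
  rewrite /string -big_split; apply: eq_bigr => k ik; rewrite -big_split.
  by apply: eq_bigr => l _; rewrite -(string_energy (lam k l) iL ik).
have HE : \sum_(1 <= i < L.+1) \sum_(d < Dz L D i) (if (i < L)%N then hole_below i.+1 (lth i d) else 0)
    + \sum_(1 <= i < L.+1) \sum_(d < Dz L D i) hole_above i.-1 (lth i d)
    + \sum_(1 <= i < L.+1) \sum_(d < Dz L D i) hole_self i (lth i d)
    - \sum_(1 <= i < L.+1) \sum_(d < Dz L D i) Psi (s i) p (lth i d)
    = - \sum_(d < D j0) pi / rcosh (pi * lth j0 d).
  rewrite -!big_split -sumrB /=.
  transitivity (\sum_(1 <= i < L.+1) (if i == j0 then
      - \sum_(d < D j0) pi / rcosh (pi * lth j0 d) else 0)).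
    apply: eq_big_nat => i iL; rewrite -!big_split -sumrB /=.
    have iE : i.-1.+1 = i by lia.
    transitivity (\sum_(d < Dz L D i) - (if i == j0 then pi / rcosh (pi * lth i d) else 0)).
      apply: eq_bigr => d _; rewrite -(hole_energy (lth i d) iL).
      by rewrite /hole_above iE.
    case: eqP => [->|_]; last by rewrite big1// oppr0.
    by rewrite sumrN /Dz; case: ifP => //; lia.
  rewrite -big_mkcond /= big_nat1_eq; case: ifP => //; lia.
exact: Z EA EB ES ES' HE SE.
Qed.

End ExcitationEnergy.

Unset Implicit Arguments.

Theorem theorem6p1 (R : realType) (L : nat) (sb : nat -> nat) (D : nat -> nat)
  (lth : nat -> nat -> R) (nu : seq nat) (lam : nat -> nat -> R) :
  (forall j, (1 <= j <= L)%N -> (0 < sb j)%N) ->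
  (forall j, (1 <= j < L)%N -> (sb j < sb j.+1)%N) ->
  forall j, (1 <= j <= L)%N ->
    DeltaE L sb D lth nu lam (sb j) =
    \sum_(d < D j) pi / rcosh (pi * lth j d).
Proof. by move=> sb0 sbS j jL; exact: DeltaE_sea. Qed.
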